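(* Let $X \subseteq \mathbb{R}^d$ be any dataset containing $n$ points and $k>1$ an integer. Let $C$ be the output of the algorithm Query-$k$-means++$(X,k)$. Then $\mathbf{E}[\Phi(C, X)] \leq 24 \cdot \Delta_k(X)$. Furthermore, the algorithm makes $O(k^2 \log{k})$ same-cluster queries and its running time is $O(nkd + k \log{k} \log{n} + k^2 \log{k})$.
   Context: $\Phi(C,X)=\sum_{x\in X}\min_{c\in C}\|x-c\|^2$ for nonempty $C$; $\Delta_k(X)$ is the optimal $k$-means cost $\min_{|C|=k}\Phi(C,X)$. A fixed optimal clustering $X_1,\dots,X_k$ is given implicitly; a same-cluster query on $x,y\in X$ returns whether $x,y$ lie in the same $X_i$. $D^2$-sampling w.r.t. nonempty $C$ samples $x\in X$ with probability $\Phi(C,\{x\})/\Phi(C,X)$. Algorithm Query-$k$-means++$(X,k)$: sample $x\in X$ uniformly at random and set $C\leftarrow\{x\}$; for $i=2$ to $k$: for $j=1$ to $\lceil\log k\rceil$: $D^2$-sample $x$ w.r.t. $C$; if no $c\in C$ lies in the same optimal cluster as $x$ (checked with same-cluster queries), set $C\leftarrow C\cup\{x\}$ and break out of the inner loop. Return $C$. *)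

(* Defs.v *)
From HB Require Import structures.
From mathcomp Require Import all_boot all_order all_algebra.
From mathcomp Require Import boolp classical_sets reals exp.
Set Implicit Arguments.
Unset Strict Implicit.
Unset Printing Implicit Defensive.
Import Order.TTheory GRing.Theory Num.Theory.
Local Open Scope ring_scope.

(** * k-means costs *)

(* Finite subsets of R^d are represented by duplicate-free sequences. *)

(* The squared Euclidean distance; the norm that the library puts on row
   vectors is the sup norm. *)
Definition sqdist (R : realFieldType) (d : nat) (x y : 'rV[R]_d) : R :=
  \sum_(j < d) (x 0 j - y 0 j) ^+ 2.

(* min_{c in C} |x - c|^2, for nonempty C. *)
Definition mindist (R : realFieldType) (d : nat) (C : seq 'rV[R]_d)
    (x : 'rV[R]_d) : R :=
  \big[Order.min/sqdist x (head 0 C)]_(c <- C) sqdist x c.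

Definition Phi (R : realFieldType) (d : nat) (C X : seq 'rV[R]_d) : R :=
  \sum_(x <- X) mindist C x.

(* The infimum is attained as soon as d > 0, also when X has fewer than k
   points: centers need not belong to X. *)
Definition Delta (R : realType) (d : nat) (k : nat) (X : seq 'rV[R]_d) : R :=
  inf [set Phi C X | C in [set C : seq 'rV[R]_d | uniq C /\ size C = k]]%classic.

(* The i-th cluster consists of the points of X with label i; it may be empty. *)
Definition optimal_clustering (R : realType) (d k : nat) (X : seq 'rV[R]_d)
    (cl : 'rV[R]_d -> 'I_k) : Prop :=
  \sum_(i < k) Delta 1 [seq x <- X | cl x == i] = Delta k X.

(** * Finitely supported distributions *)

(* A list of (probability, outcome) pairs, one for each sequence of random
   choices; an outcome may occur several times. *)
Definition dist (R : realFieldType) (T : Type) : Type := seq (R * T).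

Definition dret (R : realFieldType) (T : Type) (x : T) : dist R T :=
  [:: (1, x)].

Definition dbind (R : realFieldType) (T U : Type) (m : dist R T)
    (f : T -> dist R U) : dist R U :=
  flatten [seq [seq (p.1 * q.1, q.2) | q <- f p.2] | p <- m].

Definition dmap (R : realFieldType) (T U : Type) (f : T -> U) (m : dist R T) :
    dist R U :=
  [seq (p.1, f p.2) | p <- m].

Definition uniform (R : realFieldType) (T : Type) (s : seq T) : dist R T :=
  [seq ((size s)%:R^-1, x) | x <- s].

Definition expect (R : realFieldType) (T : Type) (m : dist R T) (f : T -> R) : R :=
  \sum_(p <- m) p.1 * f p.2.

Definition pmf (R : realFieldType) (T : eqType) (m : dist R T) (y : T) : R :=
  \sum_(p <- m | p.2 == y) p.1.

(* P holds in every run that has positive probability. *)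
Definition surely (R : realFieldType) (T : eqType) (m : dist R T)
    (P : T -> Prop) : Prop :=
  forall (w : R) (y : T), (w, y) \in m -> 0 < w -> P y.

(** * The algorithm *)

(* If Phi C X = 0, the quotients are undefined and the point is drawn
   uniformly. In the algorithm this can only occur when X has fewer than k
   points. *)
Definition D2_sample (R : realFieldType) (d : nat) (X C : seq 'rV[R]_d) :
    dist R 'rV[R]_d :=
  if Phi C X == 0 then uniform R X
  else [seq (Phi C [:: x] / Phi C X, x) | x <- X].

(* The computations below carry a pair (C, q), where q is the number of
   same-cluster queries made so far. Testing x against C takes one query for
   each element of C. *)
Fixpoint inner_loop (R : realFieldType) (d k : nat) (X : seq 'rV[R]_d)
    (cl : 'rV[R]_d -> 'I_k) (m : nat) (s : seq 'rV[R]_d * nat) :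
    dist R (seq 'rV[R]_d * nat) :=
  if m is m'.+1 then
    dbind (D2_sample X s.1) (fun x =>
      let q := (s.2 + size s.1)%N in
      if has (fun c => cl c == cl x) s.1 then inner_loop X cl m' (s.1, q)
      else dret R (rcons s.1 x, q))
  else dret R s.

Fixpoint outer_loop (R : realFieldType) (d k : nat) (X : seq 'rV[R]_d)
    (cl : 'rV[R]_d -> 'I_k) (m : nat) (s : seq 'rV[R]_d * nat) :
    dist R (seq 'rV[R]_d * nat) :=
  if m is m'.+1 then
    dbind (inner_loop X cl (up_log 2 k) s) (outer_loop X cl m')
  else dret R s.

Definition query_kmeanspp (R : realFieldType) (d k : nat) (X : seq 'rV[R]_d)
    (cl : 'rV[R]_d -> 'I_k) : dist R (seq 'rV[R]_d * nat) :=
  dbind (uniform R X) (fun x => outer_loop X cl k.-1 ([:: x], 0%N)).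

(** * A randomized real RAM with a same-cluster oracle *)

(* The memory consists of arrays of natural numbers and arrays of reals, each
   designated by a number; a register is the cell 0 of an array. *)

Inductive nexp : Type :=
| NConst of nat
| NGet of nat & nexp
| NAdd of nexp & nexp
| NSub of nexp & nexp
| NMul of nexp & nexp
| NHalf of nexp.

Inductive rexp : Type :=
| RZero
| RGet of nat & nexp
| RAdd of rexp & rexp
| RSub of rexp & rexp
| RMul of rexp & rexp
| RDiv of rexp & rexp.

Inductive bexp : Type :=
| NLt of nexp & nexp
| NEq of nexp & nexp
| RLt of rexp & rexp
| REq of rexp & rexp.

Inductive cmd : Type :=
| Skip
| NSet of nat & nexp & nexp  (* array, index, value *)
| RSet of nat & nexp & rexp  (* array, index, value *)
| Seq of cmd & cmd
| If of bexp & cmd & cmd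
| For of nat & nexp & cmd    (* register := 0, .., e - 1 *)
| Flip of nat & rexp         (* register := 1 with probability r, else 0 *)
| Rand of nat & nexp         (* register := uniform in {0, .., e - 1} *)
| Query of nat & nexp & nexp. (* register := answer of a same-cluster query *)

Record state (R : realFieldType) : Type := State {
  nmem : nat -> nat -> nat;
  rmem : nat -> nat -> R;
  time : nat;
  queries : nat
}.

Definition upd (T : Type) (m : nat -> nat -> T) (a i : nat) (v : T) :
    nat -> nat -> T :=
  fun b j => if (b == a) && (j == i) then v else m b j.

Definition nset (R : realFieldType) (a i v : nat) (s : state R) : state R :=
  State (upd (nmem s) a i v) (rmem s) (time s) (queries s).

Definition rset (R : realFieldType) (a i : nat) (v : R) (s : state R) : state R :=
  State (nmem s) (upd (rmem s) a i v) (time s) (queries s).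

Definition tick (R : realFieldType) (t : nat) (s : state R) : state R :=
  State (nmem s) (rmem s) (time s + t)%N (queries s).

Definition count_query (R : realFieldType) (s : state R) : state R :=
  State (nmem s) (rmem s) (time s) (queries s).+1.

Fixpoint neval (R : realFieldType) (s : state R) (e : nexp) : nat :=
  match e with
  | NConst n => n
  | NGet a i => nmem s a (neval s i)
  | NAdd e1 e2 => (neval s e1 + neval s e2)%N
  | NSub e1 e2 => (neval s e1 - neval s e2)%N
  | NMul e1 e2 => (neval s e1 * neval s e2)%N
  | NHalf e1 => (neval s e1)./2
  end.

Fixpoint reval (R : realFieldType) (s : state R) (e : rexp) : R :=
  match e with
  | RZero => 0
  | RGet a i => rmem s a (neval s i)
  | RAdd e1 e2 => reval s e1 + reval s e2
  | RSub e1 e2 => reval s e1 - reval s e2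
  | RMul e1 e2 => reval s e1 * reval s e2
  | RDiv e1 e2 => reval s e1 / reval s e2
  end.

Definition beval (R : realFieldType) (s : state R) (b : bexp) : bool :=
  match b with
  | NLt e1 e2 => (neval s e1 < neval s e2)%N
  | NEq e1 e2 => neval s e1 == neval s e2
  | RLt e1 e2 => reval s e1 < reval s e2
  | REq e1 e2 => reval s e1 == reval s e2
  end.

(* Every operation, memory access and constant costs one step. *)
Fixpoint ncost (e : nexp) : nat :=
  match e with
  | NConst _ => 1%N
  | NGet _ e1 | NHalf e1 => (ncost e1).+1
  | NAdd e1 e2 | NSub e1 e2 | NMul e1 e2 => (ncost e1 + ncost e2).+1%N
  end.

Fixpoint rcost (e : rexp) : nat :=
  match e with
  | RZero => 1%N
  | RGet _ i => (ncost i).+1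
  | RAdd e1 e2 | RSub e1 e2 | RMul e1 e2 | RDiv e1 e2 =>
      (rcost e1 + rcost e2).+1%N
  end.

Definition bcost (b : bexp) : nat :=
  match b with
  | NLt e1 e2 | NEq e1 e2 => (ncost e1 + ncost e2).+1%N
  | RLt e1 e2 | REq e1 e2 => (rcost e1 + rcost e2).+1%N
  end.

(* The relation [same] is the oracle; points are referred to by their index. *)
Fixpoint exec (R : realFieldType) (same : rel nat) (c : cmd) (s : state R) :
    dist R (state R) :=
  match c with
  | Skip => dret R (tick 1 s)
  | NSet a i e =>
      dret R (tick (ncost i + ncost e).+1%N (nset a (neval s i) (neval s e) s))
  | RSet a i e =>
      dret R (tick (ncost i + rcost e).+1%N (rset a (neval s i) (reval s e) s))
  | Seq c1 c2 => dbind (exec same c1 s) (exec same c2)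
  | If b c1 c2 =>
      exec same (if beval s b then c1 else c2) (tick (bcost b).+1 s)
  | For a e c1 =>
      foldl (fun m i => dbind m (fun s' => exec same c1 (tick 1 (nset a 0 i s'))))
        (dret R (tick (ncost e).+1 s)) (iota 0 (neval s e))
  | Flip a e =>
      let p := Order.max 0 (Order.min 1 (reval s e)) in
      let s' := tick (rcost e).+1 s in
      [:: (p, nset a 0 1 s'); (1 - p, nset a 0 0 s')]
  | Rand a e =>
      dmap (fun i => tick (ncost e).+1 (nset a 0 i s))
        (uniform R (iota 0 (neval s e)))
  | Query a e1 e2 =>
      dret R (count_query (tick (ncost e1 + ncost e2).+1%N%N
        (nset a 0 (same (neval s e1) (neval s e2)) s)))
  end.

Definition block (cs : seq cmd) : cmd := foldr Seq Skip cs.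

(** * Implementation of the algorithm on the RAM *)

(* Registers and arrays of natural numbers. *)
Definition vN := 0%N.      (* number of points (input) *)
Definition vK := 1%N.      (* number of clusters (input) *)
Definition vD := 2%N.      (* dimension (input) *)
Definition vLK := 3%N.     (* ceiling of log k *)
Definition vLN := 4%N.     (* ceiling of log n *)
Definition vPow := 5%N.
Definition vCen := 6%N.    (* array of the indices of the centers (output) *)
Definition vNC := 7%N.     (* number of centers (output) *)
Definition vX := 8%N.      (* index of the sampled point *)
Definition vDone := 9%N.
Definition vFound := 10%N.
Definition vAns := 11%N.
Definition vLo := 12%N.
Definition vHi := 13%N.
Definition vCoin := 14%N.
Definition vI := 15%N.
Definition vJ := 16%N.
Definition vT := 17%N.
Definition vS := 18%N.
Definition vC := 19%N.
Definition vB := 20%N.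

(* Registers and arrays of reals. *)
Definition aPt := 0%N.     (* coordinates of the points, row by row (input) *)
Definition aDist := 1%N.   (* squared distances to the closest center *)
Definition aSum := 2%N.    (* aSum[i] = aDist[0] + .. + aDist[i - 1] *)
Definition aAcc := 3%N.

Definition N0 : nexp := NConst 0.
Definition N1 : nexp := NConst 1.
Definition nvar (a : nat) : nexp := NGet a N0.
Definition rvar (a : nat) : rexp := RGet a N0.
Definition nassign (a : nat) (e : nexp) : cmd := NSet a N0 e.
Definition rassign (a : nat) (e : rexp) : cmd := RSet a N0 e.

(* l := ceil (log_2 v), for a register v >= 1. *)
Definition ram_log (l v : nat) : cmd := block [::
  nassign l N0;
  nassign vPow N1;
  For vI (nvar v)
    (If (NLt (nvar vPow) (nvar v))
      (block [::
        nassign vPow (NAdd (nvar vPow) (nvar vPow));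
        nassign l (NAdd (nvar l) N1)])
      Skip)].

Definition ram_coord_diff : rexp :=
  RSub (RGet aPt (NAdd (NMul (nvar vI) (nvar vD)) (nvar vJ)))
       (RGet aPt (NAdd (NMul (nvar vX) (nvar vD)) (nvar vJ))).

(* Append point vX to the centers; update distances and partial sums. *)
Definition ram_add_center : cmd := block [::
  NSet vCen (nvar vNC) (nvar vX);
  nassign vNC (NAdd (nvar vNC) N1);
  RSet aSum N0 RZero;
  For vI (nvar vN) (block [::
    rassign aAcc RZero;
    For vJ (nvar vD)
      (rassign aAcc (RAdd (rvar aAcc) (RMul ram_coord_diff ram_coord_diff)));
    If (NEq (nvar vNC) N1)
      (RSet aDist (nvar vI) (rvar aAcc))
      (If (RLt (rvar aAcc) (RGet aDist (nvar vI)))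
        (RSet aDist (nvar vI) (rvar aAcc))
        Skip);
    RSet aSum (NAdd (nvar vI) N1)
      (RAdd (RGet aSum (nvar vI)) (RGet aDist (nvar vI)))])].

(* vX := index of a D^2-sampled point, by dichotomy on the partial sums: an
   index range [lo, hi) is split at its middle, and a half is entered with
   probability proportional to its cost. *)
Definition ram_D2_sample : cmd :=
  If (REq (RGet aSum (nvar vN)) RZero)
    (Rand vX (nvar vN))
    (block [::
      nassign vLo N0;
      nassign vHi (nvar vN);
      For vB (nvar vLN)
        (If (NLt (NAdd (nvar vLo) N1) (nvar vHi))
          (block [::
            nassign vI (NHalf (NAdd (nvar vLo) (nvar vHi)));
            Flip vCoin
              (RDiv (RSub (RGet aSum (nvar vI)) (RGet aSum (nvar vLo)))
                    (RSub (RGet aSum (nvar vHi)) (RGet aSum (nvar vLo))));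
            If (NEq (nvar vCoin) N1)
              (nassign vHi (nvar vI))
              (nassign vLo (nvar vI))])
          Skip);
      nassign vX (nvar vLo)]).

(* vFound := 1 if some center is in the same cluster as point vX, else 0. *)
Definition ram_check : cmd := block [::
  nassign vFound N0;
  For vC (nvar vNC) (block [::
    Query vAns (NGet vCen (nvar vC)) (nvar vX);
    If (NEq (nvar vAns) N1) (nassign vFound N1) Skip])].

Definition ram_query_kmeanspp : cmd := block [::
  ram_log vLK vK;
  ram_log vLN vN;
  nassign vNC N0;
  Rand vX (nvar vN);
  ram_add_center;
  For vT (NSub (nvar vK) N1) (block [::
    nassign vDone N0;
    For vS (nvar vLK)
      (If (NEq (nvar vDone) N0)
        (block [::
          ram_D2_sample;
          ram_check;
          If (NEq (nvar vFound) N0)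
            (block [:: ram_add_center; nassign vDone N1])
            Skip])
        Skip)])].

Definition ram_input (R : realFieldType) (d k : nat) (X : seq 'rV[R]_d) : state R :=
  State
    (fun a i => if i == 0%N then
       (if a == vN then size X else if a == vK then k
        else if a == vD then d else 0%N)
     else 0%N)
    (fun a i => if a == aPt then
       (if insub (i %% d)%N is Some j then nth 0 X (i %/ d) 0 j else 0)
     else 0)
    0 0.

Definition ram_output (R : realFieldType) (d : nat) (X : seq 'rV[R]_d)
    (s : state R) : seq 'rV[R]_d :=
  [seq nth 0 X (nmem s vCen i) | i <- iota 0 (nmem s vNC 0)].

(* The outcomes are the triples (centers, number of queries, running time). *)
Definition ram_run (R : realFieldType) (d k : nat) (X : seq 'rV[R]_d)
    (cl : 'rV[R]_d -> 'I_k) : dist R (seq 'rV[R]_d * nat * nat) :=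
  dmap (fun s => (ram_output X s, queries s, time s))
    (exec (fun i j => cl (nth 0 X i) == cl (nth 0 X j))
      ram_query_kmeanspp (ram_input k X)).

(* Main.v *)
Require Import Defs.
From HB Require Import structures.
From mathcomp Require Import all_boot all_order all_algebra.
From mathcomp Require Import boolp classical_sets reals exp.
From mathcomp Require Import ring lra zify.
Import Order.TTheory GRing.Theory Num.Theory.
Local Open Scope ring_scope.
Set Implicit Arguments.
Unset Strict Implicit.
Unset Printing Implicit Defensive.

(** Approximation ratio. Split the cost of the current centers C into the part H
    of the clusters that C meets and the part U of the others, and let
    a = H + 8 (sum of Delta_1 over the clusters that C misses). A center that is
    D^2-sampled from a missed cluster A brings the cost of A down to at most
    8 Delta_1(A) in expectation, so a is a supermartingale, initially at most
    8 Delta_k(X) in expectation; hence the final cost is at most a + U in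
    expectation. If U <= H this is at most 2a. If U > H, each sample misses with
    probability r = H / (H + U) < 1/2, and the loss r^(ceil(log k)) U incurred
    when an iteration fails is at most H / (k - 1). Over the k - 1 iterations the
    losses add up to at most a, whence the factor 3 * 8 = 24.

    Implementation. Runs of the RAM program are compared with runs of the
    algorithm by a probabilistic simulation relation, whose invariant records the
    contents of the memory and bounds the clock. *)

(** * Costs of clusterings *)

Section Expectation.
Variable R : realFieldType.

Lemma expect_dret T (x : T) (F : T -> R) : expect (dret R x) F = F x.
Proof. by rewrite /expect big_seq1 mul1r. Qed.

Lemma expect_dbind T U (m : dist R T) (f : T -> dist R U) F :
  expect (dbind m f) F = expect m (fun x => expect (f x) F).
Proof.
rewrite /expect /dbind big_flatten big_map; apply: eq_bigr => p _.
by rewrite big_map mulr_sumr; apply: eq_bigr => q _; rewrite mulrA.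
Qed.

Lemma expect_dmap T U (f : T -> U) (m : dist R T) F :
  expect (dmap f m) F = expect m (F \o f).
Proof. by rewrite /expect /dmap big_map. Qed.

Lemma expect_uniform T (s : seq T) (F : T -> R) :
  expect (uniform R s) F = (size s)%:R^-1 * \sum_(x <- s) F x.
Proof. by rewrite /expect /uniform big_map mulr_sumr. Qed.

Lemma eq_expect T (m : dist R T) F G : F =1 G -> expect m F = expect m G.
Proof. by move=> FG; apply: eq_bigr => p _; rewrite FG. Qed.

(** A mass is the expectation of an indicator. Simulations compare expectations only, and this is
    how they yield equality of laws. *)
Lemma pmf_expect (T : eqType) (m : dist R T) y :
  pmf m y = expect m (fun z => (z == y)%:R).
Proof.
by rewrite /pmf /expect big_mkcond; apply: eq_bigr => p _; case: eqP;
  rewrite ?mulr1 ?mulr0.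
Qed.

End Expectation.

(** * Squared distances and the cost of a set of centers *)

Section SquaredDistance.
Variables (R : realFieldType) (d : nat).
Implicit Types (x y z c : 'rV[R]_d) (A C X : seq 'rV[R]_d).

Lemma sqdist_ge0 x y : 0 <= sqdist x y.
Proof. by apply: sumr_ge0 => j _; apply: sqr_ge0. Qed.

Lemma sqdistC x y : sqdist x y = sqdist y x.
Proof. by apply: eq_bigr => j _; rewrite -opprB sqrrN. Qed.

Lemma sqdist_triangle x y z : sqdist x z <= 2 * sqdist x y + 2 * sqdist y z.
Proof.
rewrite /sqdist !mulr_sumr -big_split /=; apply: ler_sum => j _.
have := sqr_ge0 (x 0 j - y 0 j - (y 0 j - z 0 j)).
by move: (x 0 j) (y 0 j) (z 0 j) => a b c; rewrite !expr2; nra.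
Qed.

Lemma big_min_rcons (T : Type) (F : T -> R) (u : R) (s : seq T) (c : T) :
  \big[Order.min/u]_(i <- rcons s c) F i
    = Order.min (\big[Order.min/u]_(i <- s) F i) (F c).
Proof.
elim: s => [|i s IHs] /=; first by rewrite big_cons !big_nil minC.
by rewrite !big_cons IHs minA.
Qed.

Lemma mindist1 c x : mindist [:: c] x = sqdist x c.
Proof. by rewrite /mindist big_seq1_id /= minxx. Qed.

(** Appending at the end keeps the head of a nonempty [C], hence the default value of the
    minimum. *)
Lemma mindist_rcons C y x : C != [::] ->
  mindist (rcons C y) x = Order.min (mindist C x) (sqdist x y).
Proof. by case: C => // c C _; rewrite /mindist big_min_rcons. Qed.

Lemma mindist_rcons_ler C y x : C != [::] -> mindist (rcons C y) x <= sqdist x y.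
Proof. by move=> C0; rewrite mindist_rcons // ge_min lexx orbT. Qed.

Lemma mindist_rcons_le C y x : C != [::] ->
  mindist (rcons C y) x <= mindist C x.
Proof. by move=> C0; rewrite mindist_rcons // ge_min lexx. Qed.

Lemma rcons_neq0 (T : eqType) (s : seq T) (x : T) : rcons s x != [::].
Proof. by rewrite -size_eq0 size_rcons. Qed.

(** The witness is a center nearest to [y]. At [x] it only gives an upper bound, which is what the
    triangle inequality for [mindist] needs. *)
Lemma mindist_attained C x y : C != [::] ->
  exists c, mindist C y = sqdist y c /\ mindist C x <= sqdist x c.
Proof.
case: (lastP C) => // {}C c _.
elim/last_ind: C c => [|C b IHC] c.
  by exists c; rewrite !mindist1.
have [a [Ea La]] := IHC b.
have C0 := rcons_neq0 C b.
rewrite !(mindist_rcons _ _ C0) Ea.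
case: leP => _; first by exists a; split=> //; rewrite ge_min La.
by exists c; split=> //; rewrite ge_min lexx orbT.
Qed.

Lemma mindist_ge0 C x : C != [::] -> 0 <= mindist C x.
Proof. by move=> /(mindist_attained x x) [c [-> _]]; apply: sqdist_ge0. Qed.

Lemma mindist_triangle C x y : C != [::] ->
  mindist C x <= 2 * mindist C y + 2 * sqdist x y.
Proof.
move=> /(mindist_attained x y) [c [-> Lx]]; apply: (le_trans Lx).
by rewrite addrC; apply: sqdist_triangle.
Qed.

Lemma Phi_ge0 C X : C != [::] -> 0 <= Phi C X.
Proof. by move=> C0; apply: sumr_ge0 => x _; apply: mindist_ge0. Qed.

Lemma Phi1 c X : Phi [:: c] X = \sum_(x <- X) sqdist x c.
Proof. by apply: eq_bigr => x _; rewrite mindist1. Qed.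

Lemma Phi_rcons_le C y X : C != [::] -> Phi (rcons C y) X <= Phi C X.
Proof. by move=> C0; apply: ler_sum => x _; apply: mindist_rcons_le. Qed.

Lemma Phi_rcons_ler C y X : C != [::] ->
  Phi (rcons C y) X <= \sum_(x <- X) sqdist x y.
Proof. by move=> C0; apply: ler_sum => x _; apply: mindist_rcons_ler. Qed.

(** With S the sum of the values and Q the sum of their squares, the double sum expands to 2|A|Q -
    2S^2. *)
Lemma sum_sqr_diff_le (T : Type) (A : seq T) (f : T -> R) :
  \sum_(x <- A) \sum_(y <- A) (f x - f y) ^+ 2
    <= 2 * (size A)%:R * (\sum_(x <- A) f x ^+ 2).
Proof.
pose S := \sum_(x <- A) f x; pose Q := \sum_(x <- A) f x ^+ 2.
have inner u (B : seq T) : \sum_(y <- B) (u - f y) ^+ 2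
    = (size B)%:R * u ^+ 2 - 2 * u * (\sum_(y <- B) f y) + \sum_(y <- B) f y ^+ 2.
  elim: B => [|y B IHB] /=; first by rewrite !big_nil; ring.
  by rewrite !big_cons IHB -natr1; ring.
under eq_bigr => x _ do rewrite inner -/S -/Q.
have outer (B : seq T) :
    \sum_(x <- B) ((size A)%:R * f x ^+ 2 - 2 * f x * S + Q)
      = (size A)%:R * (\sum_(x <- B) f x ^+ 2) - 2 * (\sum_(x <- B) f x) * S
        + (size B)%:R * Q.
  elim: B => [|y B IHB] /=; first by rewrite !big_nil; ring.
  by rewrite !big_cons IHB -natr1; ring.
rewrite outer -/S -/Q; have := sqr_ge0 S; rewrite expr2; lra.
Qed.

(** The previous bound is applied in each coordinate to the values shifted by [c], which have the
    same differences. *)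
Lemma sum_sqdist_pairs A c :
  \sum_(x <- A) \sum_(y <- A) sqdist x y
    <= 2 * (size A)%:R * \sum_(x <- A) sqdist x c.
Proof.
under eq_bigr => x _ do rewrite /sqdist exchange_big.
rewrite exchange_big /= [X in _ <= _ * X]exchange_big /= mulr_sumr.
apply: ler_sum => j _.
apply: le_trans (sum_sqr_diff_le A (fun x => x 0 j - c 0 j)).
by apply: ler_sum => x _; apply: ler_sum => y _; rewrite opprB addrA subrK.
Qed.

Lemma expect_D2_sample X C (F : 'rV[R]_d -> R) : Phi C X != 0 ->
  expect (D2_sample X C) F = (Phi C X)^-1 * \sum_(x <- X) mindist C x * F x.
Proof.
move=> /negbTE PC; rewrite /expect /D2_sample PC big_map mulr_sumr.
by apply: eq_bigr => x _; rewrite /= /Phi big_seq1 mulrAC mulrA mulrC mulrA.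
Qed.

Lemma expect_D2_sample0 X C (F : 'rV[R]_d -> R) : Phi C X = 0 ->
  expect (D2_sample X C) F = (size X)%:R^-1 * \sum_(x <- X) F x.
Proof. by move=> PC; rewrite /D2_sample PC eqxx expect_uniform. Qed.

End SquaredDistance.

Lemma sum_const_seq (R : pzSemiRingType) (T : Type) (s : seq T) (u : R) :
  \sum_(x <- s) u = (size s)%:R * u.
Proof. by rewrite big_const_seq count_predT iter_addr addr0 mulr_natl. Qed.

(** * The optimal cost of a single cluster *)

Section ClusterCost.
Variables (R : realType) (d : nat).
Implicit Types (x y c : 'rV[R]_d) (A C : seq 'rV[R]_d).

(** The infimum is only ever approached through its lower bounds, so that no optimal center has to
    be exhibited. *)
Lemma le_Delta1 A (u : R) :
  (forall c, u <= \sum_(x <- A) sqdist x c) -> u <= Delta 1 A.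
Proof.
move=> u_le; apply: lb_le_inf.
  by exists (Phi [:: 0] A); exists [:: 0].
by move=> _ [C [_ /= sC] <-]; case: C sC => [|c []] // _; rewrite Phi1.
Qed.

Lemma Delta1_ge0 A : 0 <= Delta 1 A.
Proof. by apply: le_Delta1 => c; apply: sumr_ge0 => x _; apply: sqdist_ge0. Qed.

(** For nonempty [A], the sum over pairs divided by 2|A| is a lower bound for the cost of every
    single center, hence for the infimum. *)
Lemma sum_sqdist_Delta1 A :
  \sum_(x <- A) \sum_(y <- A) sqdist x y <= 2 * (size A)%:R * Delta 1 A.
Proof.
case: (posnP (size A)) => [/size0nil -> | A0]; first by rewrite big_nil mulr0 mul0r.
have A0' : 0 < 2 * (size A)%:R :> R by rewrite mulr_gt0 ?ltr0n.
rewrite -ler_pdivrMl //; apply: le_Delta1 => c.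
by rewrite ler_pdivrMl //; apply: sum_sqdist_pairs.
Qed.

(* A point y of the cluster satisfies
   [|A| mindist C y <= 2 Phi C A + 2 sum_a |y - a|^2]; the new cost is bounded by
   [sum_a |y - a|^2] against the first term and by [Phi C A] against the second. *)
Lemma D2_cluster_cost A C : C != [::] ->
  \sum_(y <- A) mindist C y * Phi (rcons C y) A <= 8 * Delta 1 A * Phi C A.
Proof.
move=> C0; case: (posnP (size A)) => [/size0nil -> | A0].
  by rewrite /Phi !big_nil mulr0.
have A0' : 0 < (size A)%:R :> R by rewrite ltr0n.
have PA0 := Phi_ge0 A C0.
rewrite -(ler_pM2l A0') mulr_sumr.
apply: (@le_trans _ _ (\sum_(y <- A) 4 * Phi C A * \sum_(a <- A) sqdist y a)).
  apply: ler_sum => y _; set D := \sum_(a <- A) _.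
  have D_ge0 : 0 <= D by apply: sumr_ge0 => a _; apply: sqdist_ge0.
  have avg : (size A)%:R * mindist C y <= 2 * Phi C A + 2 * D.
    rewrite /Phi /D !mulr_sumr -big_split /=.
    rewrite [X in X <= _](_ : _ = \sum_(a <- A) mindist C y); last first.
      by rewrite sum_const_seq.
    by apply: ler_sum => a _; apply: mindist_triangle.
  have P_ge0 : 0 <= Phi (rcons C y) A by apply/Phi_ge0/rcons_neq0.
  have P_le1 := Phi_rcons_le y A C0.
  have P_le2 : Phi (rcons C y) A <= D.
    apply: le_trans (Phi_rcons_ler _ _ C0) _.
    by apply: ler_sum => a _; rewrite sqdistC.
  rewrite mulrA; apply: le_trans (ler_wpM2r P_ge0 avg) _; nra.
(* Summing over [y] produces the sum over pairs, at most 2|A| [Delta 1 A], so the constant is 4 * 2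
   = 8. *)
rewrite -mulr_sumr; apply: le_trans (ler_wpM2l _ (sum_sqdist_Delta1 A)) _.
  by rewrite mulr_ge0.
by rewrite le_eqVlt; apply/orP; left; apply/eqP; ring.
Qed.

End ClusterCost.

(** * Approximation ratio *)

Section ApproximationRatio.
Variables (R : realType) (d k : nat) (X : seq 'rV[R]_d) (cl : 'rV[R]_d -> 'I_k).
Hypothesis X_neq0 : (0 < size X)%N.
Implicit Types (x y c : 'rV[R]_d) (C : seq 'rV[R]_d) (i : 'I_k).

Definition covered C i : bool := has (fun c => cl c == i) C.

Definition cluster i : seq 'rV[R]_d := [seq x <- X | cl x == i].

Definition hit_cost C : R := \sum_(i | covered C i) Phi C (cluster i).

Definition missed_cost C : R := \sum_(i | ~~ covered C i) Phi C (cluster i).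

(** This is [a] of the overview, with [hit_cost] as H and [missed_cost] as U. A missed cluster is
    charged in advance what it is expected to cost at most once a center is sampled from it. *)
Definition potential C : R :=
  hit_cost C + \sum_(i | ~~ covered C i) 8 * Delta 1 (cluster i).

Lemma sum_cluster (F : 'rV[R]_d -> R) (P : pred 'I_k) :
  \sum_(x <- X | P (cl x)) F x = \sum_(i | P i) \sum_(x <- cluster i) F x.
Proof.
rewrite (partition_big cl P) //; apply: eq_bigr => i Pi.
rewrite big_filter; apply: eq_bigl => x.
by case: eqP => [->|]; rewrite ?Pi ?andbF.
Qed.

Lemma sum_missed C :
  \sum_(x <- X | ~~ covered C (cl x)) mindist C x = missed_cost C.
Proof. exact: (sum_cluster _ (fun i => ~~ covered C i)). Qed.

Lemma Phi_split C : Phi C X = hit_cost C + missed_cost C.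
Proof.
rewrite /Phi (sum_cluster _ predT) /hit_cost /missed_cost.
by rewrite (bigID (covered C)).
Qed.

Lemma hit_cost_ge0 C : C != [::] -> 0 <= hit_cost C.
Proof. by move=> C0; apply: sumr_ge0 => i _; apply: Phi_ge0. Qed.

Lemma missed_cost_ge0 C : C != [::] -> 0 <= missed_cost C.
Proof. by move=> C0; apply: sumr_ge0 => i _; apply: Phi_ge0. Qed.

Lemma hit_cost_le_potential C : hit_cost C <= potential C.
Proof.
by rewrite lerDl; apply: sumr_ge0 => i _; rewrite mulr_ge0 // Delta1_ge0.
Qed.

Lemma covered_rcons C x i : covered (rcons C x) i = (i == cl x) || covered C i.
Proof. by rewrite /covered has_rcons eq_sym. Qed.

Lemma missed_rcons C x : ~~ covered C (cl x) ->
  forall F : 'I_k -> R, \sum_(i | ~~ covered C i) F i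
    = F (cl x) + \sum_(i | ~~ covered (rcons C x) i) F i.
Proof.
move=> xC F; rewrite (bigD1 (cl x)) //=; congr (_ + _); apply: eq_bigl => i.
by rewrite covered_rcons negb_or andbC.
Qed.

Lemma hit_rcons C x : ~~ covered C (cl x) ->
  forall F : 'I_k -> R, \sum_(i | covered (rcons C x) i) F i
    = F (cl x) + \sum_(i | covered C i) F i.
Proof.
move=> xC F; rewrite (bigD1 (cl x)) /=; last by rewrite covered_rcons eqxx.
congr (_ + _); apply: eq_bigl => i; rewrite covered_rcons.
by case: eqP => [->|] //=; rewrite ?andbT // (negbTE xC).
Qed.

Lemma missed_cost_rcons C x : C != [::] -> ~~ covered C (cl x) ->
  missed_cost (rcons C x) <= missed_cost C.
Proof.
move=> C0 xC; rewrite {2}/missed_cost (missed_rcons xC) ler_wpDl ?Phi_ge0 //.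
by apply: ler_sum => i _; apply: Phi_rcons_le.
Qed.

(** The cluster of [x] trades its advance charge for its actual cost; the clusters hit before can
    only become cheaper. *)
Lemma potential_rcons C x : C != [::] -> ~~ covered C (cl x) ->
  potential (rcons C x) <= potential C
    + (Phi (rcons C x) (cluster (cl x)) - 8 * Delta 1 (cluster (cl x))).
Proof.
move=> C0 xC; rewrite /potential (missed_rcons xC) {1}/hit_cost (hit_rcons xC).
have : \sum_(i | covered C i) Phi (rcons C x) (cluster i) <= hit_cost C.
  by apply: ler_sum => i _; apply: Phi_rcons_le.
lra.
Qed.

(** Divided by [missed_cost C], this is the supermartingale property, conditionally on the sample
    lying in a missed cluster. *)
Lemma D2_potential C : C != [::] ->
  \sum_(x <- X | ~~ covered C (cl x)) mindist C x * potential (rcons C x)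
    <= missed_cost C * potential C.
Proof.
move=> C0.
pose G i x := Phi (rcons C x) (cluster i) - 8 * Delta 1 (cluster i).
apply: (@le_trans _ _ (\sum_(x <- X | ~~ covered C (cl x))
   (mindist C x * potential C + mindist C x * G (cl x) x))).
  apply: ler_sum => x xC; rewrite -mulrDr ler_wpM2l ?mindist_ge0 //.
  exact: potential_rcons.
rewrite big_split /= -mulr_suml sum_missed.
(* The weighted increments are grouped by the cluster of the sample; [D2_cluster_cost] makes each
   group nonpositive. *)
rewrite gerDl (partition_big cl (fun i => ~~ covered C i)) //=.
apply: sumr_le0 => i iC.
rewrite (eq_big (fun x => cl x == i) (fun x => mindist C x * G i x)); first last.
- by move=> x /andP [_ /eqP ->].
- by move=> x; case: eqP => [->|]; rewrite ?iC ?andbF.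
rewrite -big_filter -/(cluster i) /G.
under eq_bigr do rewrite mulrBr.
rewrite sumrB -mulr_suml subr_le0 [leRHS]mulrC; exact: D2_cluster_cost.
Qed.

(** * One iteration: sampling until a missed cluster is met *)

Section InnerLoop.
Variables (C : seq 'rV[R]_d) (F : seq 'rV[R]_d * nat -> R) (b e g : R).
Hypotheses (C_neq0 : C != [::]) (b_ge0 : 0 <= b).
Hypothesis F_rcons : forall x q, ~~ covered C (cl x) ->
  F (rcons C x, q) <= b * potential (rcons C x) + e.
Hypothesis F_same : forall q, F (C, q) <= g.

(** With r the probability that a sample lies in a hit cluster, all [m] samples fail with
    probability r^m, and then the value is at most [g]. Otherwise the accepted center follows the
    law of a sample conditioned on missed clusters, for which the potential does not grow in
    expectation. The parameters stay free because the bound is used with ([b], [e]) = (1, U) and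
    with (c, 0). *)
Lemma inner_loop_le m q : Phi C X != 0 ->
  expect (inner_loop X cl m (C, q)) F
    <= (1 - (hit_cost C / Phi C X) ^+ m) * (b * potential C + e)
       + (hit_cost C / Phi C X) ^+ m * g.
Proof.
move=> PC; have P_gt0 : 0 < Phi C X by rewrite lt_def PC Phi_ge0.
set r := hit_cost C / Phi C X; set K := b * potential C + e.
have r_ge0 : 0 <= r by rewrite divr_ge0 ?hit_cost_ge0 ?ltW.
have hit_r : hit_cost C = r * Phi C X by rewrite divfK.
have missed_r : missed_cost C = (1 - r) * Phi C X.
  by have := Phi_split C; rewrite {1}hit_r; lra.
elim: m q => [|m IHm] q /=; first by rewrite expect_dret expr0; have := F_same q; lra.
rewrite expect_dbind expect_D2_sample // (bigID (fun x => covered C (cl x))) /=.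
set E := (1 - r ^+ m) * K + r ^+ m * g in IHm.
have hitE : \sum_(x <- X | covered C (cl x)) mindist C x *
    expect (if has (fun c => cl c == cl x) C
            then inner_loop X cl m (C, (q + size C)%N)
            else dret R (rcons C x, (q + size C)%N)) F <= hit_cost C * E.
  rewrite /hit_cost -sum_cluster mulr_suml.
  apply: ler_sum => x; rewrite /covered => ->.
  by rewrite ler_wpM2l ?mindist_ge0.
have missE : \sum_(x <- X | ~~ covered C (cl x)) mindist C x *
    expect (if has (fun c => cl c == cl x) C
            then inner_loop X cl m (C, (q + size C)%N)
            else dret R (rcons C x, (q + size C)%N)) F <= missed_cost C * K.
  apply: (@le_trans _ _ (b * \sum_(x <- X | ~~ covered C (cl x))
      mindist C x * potential (rcons C x)
      + \sum_(x <- X | ~~ covered C (cl x)) mindist C x * e)).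
    rewrite mulr_sumr -big_split /=; apply: ler_sum => x xC.
    rewrite ifN // expect_dret mulrCA -mulrDr ler_wpM2l ?mindist_ge0 //.
    exact: F_rcons.
  rewrite -mulr_suml sum_missed.
  by rewrite /K; have := ler_wpM2l b_ge0 (D2_potential C_neq0); lra.
rewrite mulrC ler_pdivrMr //; apply: le_trans (lerD hitE missE) _.
rewrite hit_r missed_r /E exprS le_eqVlt; apply/orP; left; apply/eqP; ring.
Qed.

(** At zero cost the samples are uniform and r is undefined. But every missed cluster already costs
    0, so the potential does not grow whichever center is accepted. *)
Lemma inner_loop_le0 m q : Phi C X = 0 -> g <= b * potential C + e ->
  expect (inner_loop X cl m (C, q)) F <= b * potential C + e.
Proof.
move=> PC gK; elim: m q => [|m IHm] q /=.
  by rewrite expect_dret (le_trans (F_same q)).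
rewrite expect_dbind expect_D2_sample0 //.
have X_gt0 : 0 < (size X)%:R :> R by rewrite ltr0n.
rewrite ler_pdivrMl // -sum_const_seq.
apply: ler_sum => x _; case: ifPn => [xC|xC]; first exact: IHm.
rewrite expect_dret; apply: le_trans (F_rcons _ xC) _.
rewrite lerD2r ler_wpM2l //; apply: le_trans (potential_rcons C_neq0 xC) _.
rewrite gerDl subr_le0.
have P0 : Phi C (cluster (cl x)) <= 0.
  have := Phi_split C; rewrite PC /missed_cost (missed_rcons xC).
  have := hit_cost_ge0 C_neq0.
  have : 0 <= \sum_(i | ~~ covered (rcons C x) i) Phi C (cluster i).
    by apply: sumr_ge0 => i _; apply: Phi_ge0.
  lra.
apply: le_trans (Phi_rcons_le _ _ C_neq0) _; apply: le_trans P0 _.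
by rewrite mulr_ge0 ?Delta1_ge0.
Qed.

End InnerLoop.

(** * The whole run: adding up the losses of failed iterations *)

Let final_cost m C q : R := expect (outer_loop X cl m (C, q)) (fun o => Phi o.1 X).

(** A crude bound for any number of iterations: the potential is a supermartingale and U never
    increases, while the cost is H + U <= a + U at the end. *)
Lemma final_cost_le m C q : C != [::] ->
  final_cost m C q <= potential C + missed_cost C.
Proof.
rewrite /final_cost; elim: m C q => [|m IHm] C q C0 /=.
  by rewrite expect_dret Phi_split lerD2r hit_cost_le_potential.
rewrite expect_dbind.
pose F s := expect (outer_loop X cl m s) (fun o => Phi o.1 X).
have F_rcons x q' : ~~ covered C (cl x) ->
    F (rcons C x, q') <= 1 * potential (rcons C x) + missed_cost C.
  move=> xC; rewrite mul1r; apply: le_trans (IHm _ _ (rcons_neq0 C x)) _.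
  by rewrite lerD2l missed_cost_rcons.
have F_same q' : F (C, q') <= potential C + missed_cost C by apply: IHm.
have [PC|PC] := eqVneq (Phi C X) 0.
  by have := inner_loop_le0 C0 ler01 F_rcons F_same (up_log 2 k) q PC; rewrite mul1r; apply.
have := inner_loop_le C0 ler01 F_rcons F_same (up_log 2 k) q PC.
by rewrite mul1r -mulrDl subrK mul1r.
Qed.

(* When the missed clusters carry more than half of the cost, all [up_log 2 k]
   samples of an iteration fail with probability at most [1/k]. *)
Lemma failure_cost C : C != [::] -> (1 < k)%N -> hit_cost C < missed_cost C ->
  (k.-1)%:R * ((hit_cost C / Phi C X) ^+ up_log 2 k * missed_cost C) <= hit_cost C.
Proof.
move=> C0 k_gt1 HU; have H0 := hit_cost_ge0 C0.
have PE := Phi_split C.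
have P_gt0 : 0 < Phi C X by lra.
have kL : (k <= 2 ^ up_log 2 k)%N by apply: up_logP.
set r := hit_cost C / Phi C X.
have r_ge0 : 0 <= r by rewrite divr_ge0 // ltW.
have hit_r : hit_cost C = r * Phi C X by rewrite divfK ?gt_eqF.
have missed_r : missed_cost C = (1 - r) * Phi C X by rewrite {1}hit_r in PE; lra.
have r_le : 2 * r <= 1.
  by rewrite -(ler_pM2r P_gt0); move: HU; rewrite missed_r {1}hit_r; lra.
(* For [k = 2] there is a single sample, and the claim reduces to r (1 - r) <= r. For larger [k]
   there are at least two samples. *)
have [k2|k_gt2] := leqP k 2.
  have -> : k = 2%N by apply/eqP; rewrite eqn_leq k2.
  rewrite (_ : up_log 2 2 = 1%N) // expr1 /= mul1r missed_r [leRHS]hit_r.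
  rewrite mulrA ler_pM2r //; nra.
have [l L_eq] : exists l, up_log 2 k = l.+2.
  move: kL; case: (up_log 2 k) => [|[|l _]]; last by exists l.
    by rewrite expn0 => /(leq_trans k_gt2).
  by rewrite expn1 => /(leq_trans k_gt2).
have kL' : (k.-1)%:R <= 2 ^+ l.+2 :> R.
  by rewrite -natrX ler_nat -L_eq (leq_trans _ kL) // leq_pred.
apply: (@le_trans _ _ (2 ^+ l.+2 * (r ^+ up_log 2 k * missed_cost C))).
  by rewrite ler_wpM2r // mulr_ge0 ?exprn_ge0 ?missed_cost_ge0.
(* Bounding k - 1 by a power of 2 leaves (2r)^(l+2) (1 - r) <= r to show. All but two of the factors
   2r are bounded by 1. *)
have pow_le : (2 * r) ^+ l <= 1 by exact: (exprn_ile1 l (mulr_ge0 (ler0n R 2) r_ge0) r_le).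
rewrite mulrA L_eq -exprMn missed_r [leRHS]hit_r mulrA ler_pM2r // -[l.+2]addn2 exprD.
have pow_ge : 0 <= (2 * r) ^+ l by rewrite exprn_ge0 // (mulr_ge0 (ler0n R 2) r_ge0).
move: pow_le pow_ge; set y := _ ^+ l => y1 y0.
(* The two sides differ by r (2r - 1)^2. *)
have le_r : (2 * r) ^+ 2 * (1 - r) <= r.
  have := sqr_ge0 (2 * r - 1); rewrite !expr2 => sq.
  have := mulr_ge0 r_ge0 sq; nra.
rewrite -mulrA; apply: le_trans le_r; rewrite ler_piMl //.
by rewrite mulr_ge0 ?sqr_ge0 //; lra.
Qed.

Lemma missed_cost0 C : #|[pred i | ~~ covered C i]| = 0%N -> missed_cost C = 0.
Proof.
by move=> /card0_eq u0; rewrite /missed_cost big_pred0 // => i; have := u0 i.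
Qed.

(** The 2 comes from a + U <= 2a when U <= H; each remaining iteration adds 1 / (k - 1) for the risk
    that it fails. As at most [m] clusters are missed, success in every iteration leaves none
    missed. *)
Lemma final_cost_le_potential m C q :
    C != [::] -> (1 < k)%N -> (#|[pred i | ~~ covered C i]| <= m)%N ->
  final_cost m C q <= (2 + m%:R / (k.-1)%:R) * potential C.
Proof.
move=> + k_gt1; have k0 : 0 < (k.-1)%:R :> R by rewrite ltr0n; case: (k) k_gt1 => [|[]].
elim: m C q => [|m IHm] C q C0 u_le.
  have U0 : missed_cost C = 0 by apply/missed_cost0/eqP; rewrite -leqn0.
  have := final_cost_le 0 q C0; rewrite U0 mul0r.
  by have := hit_cost_le_potential C; have := hit_cost_ge0 C0; lra.
have H0 := hit_cost_ge0 C0; have Ha := hit_cost_le_potential C.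
have coef_ge0 : 0 <= m%:R / (k.-1)%:R :> R by rewrite divr_ge0.
set c := 2 + m%:R / _ in IHm *.
have c_ge2 : 2 <= c by rewrite /c; lra.
have -> : 2 + m.+1%:R / (k.-1)%:R = c + (k.-1)%:R^-1 
  by rewrite /c -[m.+1%:R]natr1 mulrDl mul1r addrA.
have kV0 : 0 <= (k.-1)%:R^-1 :> R by rewrite invr_ge0.
have [UH|HU] := leP (missed_cost C) (hit_cost C).
  apply: le_trans (final_cost_le _ _ C0) _; nra.
rewrite /final_cost /= expect_dbind.
pose F s := expect (outer_loop X cl m s) (fun o => Phi o.1 X).
have F_rcons x q' : ~~ covered C (cl x) ->
    F (rcons C x, q') <= c * potential (rcons C x) + 0.
  move=> xC; rewrite addr0; apply: IHm; rewrite ?rcons_neq0 //.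
  rewrite -ltnS; apply: leq_trans u_le; rewrite (cardD1 (cl x) [pred i | ~~ covered C i]).
  rewrite inE xC add1n ltnS; apply: eq_leq; apply: eq_card => i.
  by rewrite !inE covered_rcons negb_or.
(* After a failure one iteration is lost but no cluster is gained, so the induction hypothesis does
   not apply and the crude bound takes its place. *)
have F_same q' : F (C, q') <= potential C + missed_cost C by apply: final_cost_le.
have PE := Phi_split C.
have PC : Phi C X != 0 by rewrite gt_eqF //; lra.
have c_ge0 : 0 <= c by lra.
apply: le_trans (inner_loop_le C0 c_ge0 F_rcons F_same _ q PC) _.
have := failure_cost C0 k_gt1 HU.
rewrite mulrC -ler_pdivlMr // mulrC.
have : 0 <= (hit_cost C / Phi C X) ^+ up_log 2 k.
  by rewrite exprn_ge0 // divr_ge0 //; lra.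
set f := _ ^+ _ => f0 fU.
have HkV := ler_wpM2l kV0 Ha.
(* In the failure branch the potential has coefficient 1 instead of c; only the surplus f U <= H /
   (k - 1) <= a / (k - 1) has to be paid. *)
have : 0 <= f * ((c - 1) * potential C).
  by rewrite mulr_ge0 // mulr_ge0 //; lra.
lra.
Qed.

(** For a first center uniform in a cluster A, the expected cost of A is at most 2 [Delta 1] A by
    the bound on pairs, which is below the charge of 8 [Delta 1] A. *)
Lemma sum_potential1 :
  \sum_(x <- X) potential [:: x] <= (size X)%:R * (8 * \sum_i Delta 1 (cluster i)).
Proof.
pose G i x := Phi [:: x] (cluster i) - 8 * Delta 1 (cluster i).
set S := 8 * _.
have potE x : potential [:: x] = S + G (cl x) x.
  rewrite /potential /hit_cost /S mulr_sumr.
  rewrite (bigD1 (cl x) (P := fun i => true)) //=.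
  rewrite (eq_bigl (fun i => i == cl x)); last first.
    by move=> i; rewrite /covered /= orbF eq_sym.
  rewrite big_pred1_eq (eq_bigl (fun i => i != cl x)); last first.
    by move=> i; rewrite /covered /= orbF eq_sym.
  by rewrite /G; ring.
under eq_bigr do rewrite potE.
rewrite big_split /= sum_const_seq gerDl.
rewrite (partition_big cl predT) //=; apply: sumr_le0 => i _.
rewrite (eq_bigr (G i)); last by move=> x /eqP ->.
rewrite -big_filter -/(cluster i) sumrB subr_le0 sum_const_seq.
under eq_bigr do rewrite Phi1.
rewrite exchange_big /=; apply: le_trans (sum_sqdist_Delta1 _) _.
rewrite -mulrA [leLHS]mulrCA ler_wpM2l // ler_wpM2r ?Delta1_ge0 //.
by rewrite ler_nat.
Qed.

Lemma query_kmeanspp_cost : (1 < k)%N ->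
  expect (query_kmeanspp X cl) (fun o => Phi o.1 X)
    <= 24 * \sum_i Delta 1 (cluster i).
Proof.
move=> k_gt1; rewrite /query_kmeanspp expect_dbind expect_uniform.
rewrite ler_pdivrMl ?ltr0n //.
apply: (@le_trans _ _ (\sum_(x <- X) 3 * potential [:: x])); last first.
  by rewrite -mulr_sumr; have := sum_potential1; lra.
apply: ler_sum => x _.
have k0 : (k.-1)%:R != 0 :> R by rewrite pnatr_eq0; case: (k) k_gt1 => [|[]].
(* The first center hits one label, so k - 1 are missed and the factor is 2 + 1 = 3. *)
have := @final_cost_le_potential k.-1 [:: x] 0%N isT k_gt1.
rewrite divff // (_ : 2 + 1 = 3 :> R); last by ring.
apply; rewrite -ltnS (ltn_predK k_gt1).
rewrite -[X in (_ < X)%N](card_ord k).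
rewrite (cardD1 (cl x) 'I_k) inE add1n ltnS; apply/eq_leq/eq_card.
by move=> i; rewrite !inE /covered /= orbF eq_sym andbT.
Qed.

End ApproximationRatio.

(** * Simulation of distributions *)

Section Simulation.
Variable R : realFieldType.

(* [rel] supports a coupling of [m] and [m']; phrased through expectations, this
   is insensitive to the order and the multiplicity of the outcomes in the lists. *)
Definition sim T U (m : dist R T) (m' : dist R U) (rel : T -> U -> Prop) : Prop :=
  forall F G, (forall s t, rel s t -> F s = G t) -> expect m F = expect m' G.

(** A postcondition, expressed as simulation of the trivial program. Constant test functions show
    that it also forces total mass 1. *)
Definition runs T (m : dist R T) (P : T -> Prop) : Prop :=
  sim m (dret R tt) (fun s _ => P s).

Lemma sim_ret T U (s : T) (t : U) (rel : T -> U -> Prop) :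
  rel s t -> sim (dret R s) (dret R t) rel.
Proof. by move=> st F G FG; rewrite !expect_dret; apply: FG. Qed.

Lemma sim_bind T U T' U' (m : dist R T) (m' : dist R U)
    (f : T -> dist R T') (g : U -> dist R U') rel rel' :
  sim m m' rel -> (forall s t, rel s t -> sim (f s) (g t) rel') ->
  sim (dbind m f) (dbind m' g) rel'.
Proof.
move=> mm fg F G FG; rewrite !expect_dbind; apply: mm => s t st.
exact: (fg s t st).
Qed.

(** Internal steps of the machine, to which nothing corresponds on the other side. *)
Lemma runs_bind T T' U (m : dist R T) (f : T -> dist R T') (m' : dist R U)
    (P : T -> Prop) rel :
  runs m P -> (forall s, P s -> sim (f s) m' rel) -> sim (dbind m f) m' rel.
Proof.
move=> mP fm F G FG; rewrite expect_dbind.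
rewrite (mP _ (fun=> expect m' G)) ?expect_dret // => s _ Ps.
exact: (fm s Ps).
Qed.

Lemma sim_bind_ret T T' U (m : dist R T) (f : T -> dist R T') (m' : dist R U)
    rel (rel' : T' -> U -> Prop) :
  sim m m' rel -> (forall s t, rel s t -> sim (f s) (dret R t) rel') ->
  sim (dbind m f) m' rel'.
Proof.
move=> mm fr F G FG; rewrite expect_dbind; apply: mm => s t st.
by rewrite (fr s t st F G FG) expect_dret.
Qed.

Lemma runs_dret T U (m : dist R T) (t : U) (P : T -> Prop) (rel : T -> U -> Prop) :
  runs m P -> (forall s, P s -> rel s t) -> sim m (dret R t) rel.
Proof.
move=> mP Prel F G FG; rewrite expect_dret (mP F (fun=> G t)) ?expect_dret //.
by move=> s _ /Prel; apply: FG.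
Qed.

Lemma sim_mono T U (m : dist R T) (m' : dist R U) (rel rel' : T -> U -> Prop) :
  sim m m' rel -> (forall s t, rel s t -> rel' s t) -> sim m m' rel'.
Proof. by move=> mm rr F G FG; apply: mm => s t /rr; apply: FG. Qed.

(** Tested on the indicator that [P] fails, the simulation gives expectation 0. As the weights are
    nonnegative, no failing outcome has positive weight. *)
Lemma sim_surely T (U : eqType) (m : dist R T) (m' : dist R U) rel
    (V : eqType) (f : T -> V) (P : V -> bool) :
  sim m m' rel -> (forall s t, rel s t -> P (f s)) ->
  all (fun p => 0 <= p.1) m -> surely (dmap f m) P.
Proof.
move=> mm relP m_ge0 w y wy w_gt0; apply/negPn/negP => Py.
pose F s : R := (~~ P (f s))%:R.
have E0 : expect m F = 0.
  rewrite (mm F (fun=> 0)) /expect; last by move=> s t /relP; rewrite /F => ->.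
  by rewrite big1 // => p _; rewrite mulr0.
suff : 0 < expect m F by rewrite E0 ltxx.
move: wy m_ge0 => {mm relP E0}; rewrite /expect; elim: m => //= p m IHm.
rewrite inE big_cons => /orP [/eqP [w_p y_p] /andP [_ m_ge0]|wy /andP [p0 m_ge0]].
  rewrite ltr_pwDl //; first by rewrite /F -y_p Py -w_p mulr1.
  elim: m {IHm} m_ge0 => [|q m IHm] /=; first by rewrite big_nil.
  by case/andP=> q0 /IHm m0; rewrite big_cons addr_ge0 // mulr_ge0.
by rewrite ltr_wpDl ?IHm // mulr_ge0.
Qed.

Lemma all_dbind T U (m : dist R T) (f : T -> dist R U) (P : pred (R * U)) :
  all P (dbind m f)
    = all (fun p => all (fun q => P (p.1 * q.1, q.2)) (f p.2)) m.
Proof. by rewrite /dbind; elim: m => //= p m IHm; rewrite all_cat IHm all_map. Qed.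

End Simulation.

Local Arguments exec : simpl never.

(** * Rules for executing commands symbolically *)

Section Commands.
Variables (R : realFieldType) (same : rel nat).
Implicit Types (s : state R) (c : cmd).

Notation exec := (@exec R same).

Lemma exec_ge0 c s : all (fun p => 0 <= p.1) (exec c s).
Proof.
have ret s' : all (fun p : R * state R => 0 <= p.1) (dret R s').
  by rewrite /= ler01.
have bind (m : dist R (state R)) f :
    all (fun p => 0 <= p.1) m -> (forall x, all (fun p => 0 <= p.1) (f x)) ->
    all (fun p : R * state R => 0 <= p.1) (dbind m f).
  move=> mP fP; rewrite all_dbind; apply: sub_all mP => p pP.
  by apply: sub_all (fP p.2) => q qP; apply: mulr_ge0.
elim: c s => [|a i e|a i e|c1 IH1 c2 IH2|b c1 IH1 c2 IH2|a e c IH|a e|a e|a e1 e2] s;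
  rewrite /Defs.exec -/Defs.exec; try exact: ret.
- exact: bind.
- by case: (beval s b).
- set m := dret R _; have : all (fun p => 0 <= p.1) m by apply: ret.
  elim: (iota _ _) m => //= i r IHr m m0; apply: IHr; apply: bind => // x.
- by rewrite /= le_max lexx /= subr_ge0 ge_max ler01 ge_min lexx.
- rewrite /dmap /uniform all_map all_map; apply/allP => i _ /=.
  by rewrite invr_ge0.
Qed.

Lemma expect_seq c1 c2 s F :
  expect (exec (Seq c1 c2) s) F
    = expect (exec c1 s) (fun s' => expect (exec c2 s') F).
Proof. exact: expect_dbind. Qed.

Lemma expect_if b c1 c2 s F :
  expect (exec (If b c1 c2) s) F
    = expect (exec (if beval s b then c1 else c2) (tick (bcost b).+1 s)) F.
Proof. by []. Qed.

Lemma expect_flip a e s F :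
  let p := Order.max 0 (Order.min 1 (reval s e)) in
  expect (exec (Flip a e) s) F
    = p * F (nset a 0 1 (tick (rcost e).+1 s))
      + (1 - p) * F (nset a 0 0 (tick (rcost e).+1 s)).
Proof. by rewrite /expect big_cons big_seq1. Qed.

Lemma sim_seq_dbind U V c1 c2 s (m : dist R U) (g : U -> dist R V) rel rel' :
  sim (exec c1 s) m rel -> (forall s' t, rel s' t -> sim (exec c2 s') (g t) rel') ->
  sim (exec (Seq c1 c2) s) (dbind m g) rel'.
Proof. exact: sim_bind. Qed.

(** Associativity of [dbind] at the level of expectations; it exposes the first command of a nested
    sequence. *)
Lemma sim_seq_bind U c1 c2 s (g : state R -> dist R (state R)) (m' : dist R U) rel :
  sim (dbind (exec c1 s) (fun s' => dbind (exec c2 s') g)) m' rel ->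
  sim (dbind (exec (Seq c1 c2) s) g) m' rel.
Proof.
move=> h F G FG; rewrite -(h F G FG) expect_dbind expect_seq expect_dbind.
by apply: eq_expect => s'; rewrite expect_dbind.
Qed.

Lemma sim_skip U s (m' : dist R U) rel :
  sim (dret R (tick 1 s)) m' rel -> sim (exec Skip s) m' rel.
Proof. by []. Qed.

Lemma sim_seq U c1 c2 s (m' : dist R U) P rel :
  runs (exec c1 s) P -> (forall s', P s' -> sim (exec c2 s') m' rel) ->
  sim (exec (Seq c1 c2) s) m' rel.
Proof. exact: runs_bind. Qed.

Lemma sim_dbind_dret T U (s : T) (f : T -> dist R (state R)) (m' : dist R U) rel :
  sim (f s) m' rel -> sim (dbind (dret R s) f) m' rel.
Proof. by move=> fs; move=> F G FG; rewrite expect_dbind expect_dret; apply: fs. Qed.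

Lemma sim_nset U a i e c s (m' : dist R U) rel :
  sim (exec c (tick (ncost i + ncost e).+1 (nset a (neval s i) (neval s e) s))) m' rel ->
  sim (exec (Seq (NSet a i e) c) s) m' rel.
Proof. exact: sim_dbind_dret. Qed.

Lemma sim_rset U a i e c s (m' : dist R U) rel :
  sim (exec c (tick (ncost i + rcost e).+1 (rset a (neval s i) (reval s e) s))) m' rel ->
  sim (exec (Seq (RSet a i e) c) s) m' rel.
Proof. exact: sim_dbind_dret. Qed.

Lemma sim_query U a e1 e2 c s (m' : dist R U) rel :
  sim (exec c (count_query (tick (ncost e1 + ncost e2).+1
    (nset a 0 (same (neval s e1) (neval s e2)) s)))) m' rel ->
  sim (exec (Seq (Query a e1 e2) c) s) m' rel.
Proof. exact: sim_dbind_dret. Qed.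

Lemma sim_if U b c1 c2 s (m' : dist R U) rel :
  sim (exec (if beval s b then c1 else c2) (tick (bcost b).+1 s)) m' rel ->
  sim (exec (If b c1 c2) s) m' rel.
Proof. by []. Qed.

(** A right-nested unfolding of [For], in the recursive shape of [inner_loop] and [outer_loop];
    [exec] folds from the left instead. *)
Fixpoint iterate a c i m s : dist R (state R) :=
  if m is m'.+1 then
    dbind (exec c (tick 1 (nset a 0 i s))) (iterate a c i.+1 m')
  else dret R s.

Lemma expect_for a e c s F :
  expect (exec (For a e c) s) F
    = expect (iterate a c 0 (neval s e) (tick (ncost e).+1 s)) F.
Proof.
rewrite /Defs.exec -/Defs.exec.
(* Generalized over the first index and the distribution accumulated so far. *)
suff loop N i m : expect (foldl (fun m i => dbind m
      (fun s' => exec c (tick 1 (nset a 0 i s')))) m (iota i N)) F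
    = expect m (fun s' => expect (iterate a c i N s') F).
  by rewrite loop expect_dret.
elim: N i m => [|N IHN] i m /=.
  by apply: eq_expect => s'; rewrite expect_dret.
rewrite IHN expect_dbind; apply: eq_expect => s'.
by rewrite expect_dbind.
Qed.

Lemma sim_for U a e c s (m' : dist R U) rel :
  sim (iterate a c 0 (neval s e) (tick (ncost e).+1 s)) m' rel ->
  sim (exec (For a e c) s) m' rel.
Proof. by move=> it F G FG; rewrite expect_for; apply: it. Qed.

Lemma runs_iterate (I : nat -> state R -> Prop) a c i m s :
  I i s ->
  (forall j s', (i <= j < i + m)%N -> I j s' ->
     runs (exec c (tick 1 (nset a 0 j s'))) (I j.+1)) ->
  runs (iterate a c i m s) (I (i + m)%N).
Proof.
elim: m i s => [|m IHm] i s Is step /=; first by rewrite addn0; apply: sim_ret.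
rewrite addnS -addSn; apply: (@runs_bind _ _ _ _ _ _ _ (I i.+1)).
  by apply: step => //; rewrite leqnn addnS ltnS leq_addr.
by move=> s' Is'; apply: IHm => // j s'' ji; apply: step; lia.
Qed.

Lemma runs_for (I : nat -> state R -> Prop) a e c s :
  I 0%N (tick (ncost e).+1 s) ->
  (forall j s', (j < neval s e)%N -> I j s' ->
     runs (exec c (tick 1 (nset a 0 j s'))) (I j.+1)) ->
  runs (exec (For a e c) s) (I (neval s e)).
Proof.
by move=> I0 step; apply: sim_for; apply: (runs_iterate (i := 0)).
Qed.

(** The lists name the arrays that may change. Clock and query counter are left free and are tracked
    separately. *)
Definition frame (ns rs : seq nat) s s' : Prop :=
  (forall a i, a \notin ns -> nmem s' a i = nmem s a i) /\
  (forall a i, a \notin rs -> rmem s' a i = rmem s a i).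

Lemma frame_refl ns rs s : frame ns rs s s.
Proof. by []. Qed.

Lemma frame_trans ns rs s1 s2 s3 :
  frame ns rs s1 s2 -> frame ns rs s2 s3 -> frame ns rs s1 s3.
Proof.
by move=> [n12 r12] [n23 r23]; split=> a i ai; rewrite ?n23 ?r23 ?n12 ?r12.
Qed.

Lemma frame_sub ns rs ns' rs' s s' :
  all (mem ns') ns -> all (mem rs') rs -> frame ns rs s s' -> frame ns' rs' s s'.
Proof.
move=> /allP nn /allP rr [n r]; split=> a i ai.
  by apply: n; apply: contra ai => /nn.
by apply: r; apply: contra ai => /rr.
Qed.

Lemma frame_nset ns rs a i v s s' :
  a \in ns -> frame ns rs s s' -> frame ns rs s (nset a i v s').
Proof.
move=> ans [n r]; split=> b j bj; last exact: r.
rewrite /= /upd; case: eqP => [ba|_] /=; last exact: n.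
by rewrite ba ans in bj.
Qed.

Lemma frame_rset ns rs a i v s s' :
  a \in rs -> frame ns rs s s' -> frame ns rs s (rset a i v s').
Proof.
move=> ans [n r]; split=> b j bj; first exact: n.
rewrite /= /upd; case: eqP => [ba|_] /=; last exact: r.
by rewrite ba ans in bj.
Qed.

Lemma frame_tick ns rs t s s' : frame ns rs s s' -> frame ns rs s (tick t s').
Proof. by []. Qed.

Lemma frame_count ns rs s s' : frame ns rs s s' -> frame ns rs s (count_query s').
Proof. by []. Qed.

End Commands.

Ltac solve_frame :=
  repeat lazymatch goal with
  | |- frame _ _ ?s ?s => exact: frame_refl
  | |- frame _ _ _ (tick _ _) => apply: frame_tick
  | |- frame _ _ _ (count_query _) => apply: frame_count
  | |- frame _ _ _ (nset _ _ _ _) =>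
      apply: frame_nset; [by [] || by rewrite !inE eqxx ?orbT |]
  | |- frame _ _ _ (rset _ _ _ _) => apply: frame_rset; [by [] |]
  | |- frame _ _ _ _ => assumption
  end.

(** * Computing logarithms and testing a point against the centers *)

Section Subroutines.
Variables (R : realFieldType) (same : rel nat).
Notation exec := (@exec R same).

Lemma ram_log_spec l v s :
    l != v -> l != vPow -> l != vI -> v != vPow -> v != vI -> (0 < nmem s v 0)%N ->
  runs (exec (ram_log l v) s) (fun s' =>
    [/\ nmem s' l 0 = up_log 2 (nmem s v 0), frame [:: l; vPow; vI] [::] s s',
        queries s' = queries s &
        (time s' <= time s + 50 * (nmem s v 0).+1)%N]).
Proof.
move=> lv lp li vp vi N_gt0.
set N := nmem s v 0 in N_gt0 *.
do 2 apply: sim_nset.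
set s0 := tick _ _.
(* Either 2^e has reached N, or every pass so far has doubled and [e = i]. The strict bound on
   2^(e-1) makes the final [e] minimal. *)
pose I i s' := exists e, [/\ nmem s' l 0 = e /\ nmem s' vPow 0 = (2 ^ e)%N,
   (e == 0%N) || (2 ^ e.-1 < N)%N, (N <= 2 ^ e)%N || (e == i),
   frame [:: l; vPow; vI] [::] s s' /\ queries s' = queries s &
   (time s' <= time s + 20 + 40 * i)%N].
apply: (@sim_seq _ _ _ _ _ _ _ (I N)); last first.
  move=> s' [e [[le _] e0 Ne [fr qu] ti]]; apply: sim_ret; split=> //=; last by lia.
  (* N passes suffice because N < 2^N. *)
  rewrite le -/N; have {}Ne : (N <= 2 ^ e)%N.
    by case/orP: Ne => // /eqP ->; apply/ltnW/ltn_expl.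
  case: e e0 Ne {le} => [|e] /= e0 Ne.
    by have -> : N = 1%N by lia.
  by apply/esym/up_log_eq => //; rewrite e0.
have vN' : neval s0 (nvar v) = N.
  by rewrite /s0 /= /upd (negbTE vp) eq_sym (negbTE lv).
rewrite -vN'; apply: runs_for.
  exists 0%N; split=> //=.
  - by rewrite /upd (negbTE lp) !eqxx.
  - by rewrite orbT.
  - by split=> //; rewrite /s0; solve_frame.
  - by lia.
move=> i s' _ [e [[le pe] e0 Ne [fr qu] ti]].
have vs' : nmem s' v 0 = N.
  by rewrite fr.1 // !inE !negb_or eq_sym lv vp vi.
apply: sim_if => /=; rewrite /upd /= (negbTE vi) /= vs' pe.
case: ltnP => [lt_eN|le_Ne].
  do 2 apply: sim_nset; apply: sim_skip; apply: sim_ret; exists e.+1; split=> //=.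
  - rewrite /upd /= !eqxx /= [vPow == l]eq_sym !(negbTE lp) (negbTE li) /= le pe.
    by split; rewrite ?expnS; lia.
  - by move: Ne; rewrite leqNgt lt_eN /= => /eqP ->; rewrite eqxx orbT.
  - by split=> //; solve_frame.
  - by lia.
apply: sim_skip; apply: sim_ret; exists e; split=> //=.
- by rewrite /upd (negbTE li).
- by rewrite le_Ne.
- by split=> //; solve_frame.
- by lia.
Qed.

(** The scan has no early exit, so the number of queries is exactly the number of centers, as in
    [inner_loop]. *)
Lemma ram_check_spec s : runs (exec ram_check s) (fun s' =>
    [/\ nmem s' vFound 0 = has (fun i => same (nmem s vCen i) (nmem s vX 0))
                             (iota 0 (nmem s vNC 0)) :> nat,
        frame [:: vFound; vC; vAns] [::] s s',
        queries s' = (queries s + nmem s vNC 0)%N &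
        (time s' <= time s + 50 * (nmem s vNC 0).+1)%N]).
Proof.
apply: sim_nset; set s0 := tick _ _.
pose I i s' := [/\ nmem s' vFound 0 = has (fun i => same (nmem s vCen i) (nmem s vX 0))
                             (iota 0 i) :> nat,
    frame [:: vFound; vC; vAns] [::] s s', queries s' = (queries s + i)%N &
    (time s' <= time s + 20 + 40 * i)%N].
apply: (@sim_seq _ _ _ _ _ _ _ (I (nmem s vNC 0))); last first.
  by move=> s' [fo fr qu ti]; apply: sim_ret; split=> //=; lia.
have -> : nmem s vNC 0 = neval s0 (nvar vNC) by [].
apply: runs_for.
  by split=> //=; [rewrite /s0; solve_frame | rewrite addn0 | lia].
move=> i s' _ [fo fr qu ti].
apply: sim_query; set s1 := count_query _.
have an : nmem s1 vAns 0 = same (nmem s vCen i) (nmem s vX 0) :> nat.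
  by rewrite /s1 /= /upd /= !fr.1.
have fr1 : frame [:: vFound; vC; vAns] [::] s s1 by rewrite /s1; solve_frame.
have fo1 : nmem s1 vFound 0 = nmem s' vFound 0 by [].
have ti1 : (time s1 <= time s' + 20)%N by rewrite /s1 /=; lia.
have qu1 : queries s1 = (queries s').+1 by [].
clearbody s1.
apply: (@sim_seq _ _ _ _ _ _ _ (fun s2 => I i.+1 (tick 1 s2))); last first.
  by move=> s2 Is2; apply: sim_ret.
apply: sim_if => /=.
have hasS : has (fun i => same (nmem s vCen i) (nmem s vX 0)) (iota 0 i.+1)
    = has (fun i => same (nmem s vCen i) (nmem s vX 0)) (iota 0 i)
      || same (nmem s vCen i) (nmem s vX 0).
  by rewrite -addn1 iotaD has_cat /= orbF.
rewrite an; case sm: (same _ _) an hasS => an hasS /=.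
  by apply: sim_ret; split;
    [rewrite hasS orbT | solve_frame | rewrite /=; lia | rewrite /=; lia].
by apply: sim_ret; split;
  [rewrite hasS orbF [LHS]fo1 | solve_frame | rewrite /=; lia | rewrite /=; lia].
Qed.

End Subroutines.

(** * The RAM implementation *)

Section Implementation.
Variables (R : realFieldType) (d k : nat) (X : seq 'rV[R]_d) (cl : 'rV[R]_d -> 'I_k).
Local Notation point i := (nth 0 X i).
Local Notation same := (fun i j => cl (point i) == cl (point j)).
Local Notation exec := (@exec R same).
Local Notation n := (size X).
Implicit Types (s : state R) (C : seq 'rV[R]_d).

Lemma ram_input_point i (j : 'I_d) :
  rmem (ram_input k X) aPt (i * d + j)%N = point i 0 j.
Proof.
have d_gt0 : (0 < d)%N by apply: leq_ltn_trans (ltn_ord j).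
rewrite /= modnMDl modn_small // divnMDl // divn_small // addn0.
by rewrite insubT //= => jd; congr (point i 0 _); apply: val_inj.
Qed.

Lemma ram_input_sqdist i x :
  \sum_(0 <= j < d) ((rmem (ram_input k X) aPt (i * d + j)%N
      - rmem (ram_input k X) aPt (x * d + j)%N)
      * (rmem (ram_input k X) aPt (i * d + j)%N
      - rmem (ram_input k X) aPt (x * d + j)%N))
    = sqdist (point i) (point x).
Proof.
by rewrite big_mkord; apply: eq_bigr => j _; rewrite !ram_input_point expr2.
Qed.

Definition data s : Prop :=
  [/\ nmem s vN 0 = n, nmem s vD 0 = d
    & forall i, rmem s aPt i = rmem (ram_input k X) aPt i].

(** There are n + 1 partial sums; the last one is [Phi C X]. *)
Definition costs C s : Prop :=
  (forall i, (i < n)%N -> rmem s aDist i = mindist C (point i)) /\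
  (forall i, (i <= n)%N -> rmem s aSum i = \sum_(0 <= j < i) mindist C (point j)).

Lemma size_ram_output s : size (ram_output X s) = nmem s vNC 0.
Proof. by rewrite size_map size_iota. Qed.

Lemma ram_output_frame ns rs s s' : frame ns rs s s' ->
  vCen \notin ns -> vNC \notin ns -> ram_output X s' = ram_output X s.
Proof.
move=> [fr _] cen nc; rewrite /ram_output fr //; apply/eq_map => i; by rewrite fr.
Qed.

(** The first center overwrites the distances, whatever they were; later ones are compared with the
    stored minima. Hence [costs] is required only of nonempty [C]. *)
Lemma ram_add_center_spec C s : data s -> ram_output X s = C ->
    (C != [::] -> costs C s) ->
  runs (exec ram_add_center s) (fun s' =>
    [/\ ram_output X s' = rcons C (point (nmem s vX 0)),
        costs (rcons C (point (nmem s vX 0))) s',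
        frame [:: vCen; vNC; vI; vJ] [:: aDist; aSum; aAcc] s s',
        queries s' = queries s &
        (time s' <= time s + 100 + n * (50 * d + 200))%N]).
Proof.
move=> [sN sD sP] outC cC; set x := nmem s vX 0; set C' := rcons C _.
have NC : nmem s vNC 0 = size C by rewrite -outC size_ram_output.
do 2 apply: sim_nset; apply: sim_rset; set s1 := tick _ (rset _ _ _ _).
have fr1 : frame [:: vCen; vNC; vI; vJ] [:: aDist; aSum; aAcc] s s1.
  by rewrite /s1; solve_frame.
have NC1 : nmem s1 vNC 0 = (size C).+1 by rewrite /s1 /= /upd /= NC addn1.
have out1 : ram_output X s1 = C'.
  rewrite /ram_output NC1 -[(size C).+1]addn1 iotaD map_cat cats1 /C'.
  congr (rcons _ _); last by rewrite /s1 /= /upd /= NC eqxx.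
  rewrite -[RHS]outC /ram_output NC; apply/eq_in_map => i; rewrite mem_iota /= => iC.
  by rewrite /s1 /= /upd /= NC (ltn_eqF iC).
have S1 : rmem s1 aSum 0 = 0 by [].
have D1 i : rmem s1 aDist i = rmem s aDist i by [].
have q1 : queries s1 = queries s by [].
have t1 : (time s1 <= time s + 50)%N by rewrite /s1 /=; lia.
clearbody s1.
have N1 : nmem s1 vN 0 = n by rewrite fr1.1.
have x1 : nmem s1 vX 0 = x by rewrite fr1.1.
have D1' : nmem s1 vD 0 = d by rewrite fr1.1.
have P1 i : rmem s1 aPt i = rmem (ram_input k X) aPt i by rewrite fr1.2.
(* Distances below [i] are updated and the others are still the old ones, which the comparison
   needs; the partial sums are correct up to [i] included. *)
pose I i s' := [/\ frame [:: vI; vJ] [:: aDist; aSum; aAcc] s1 s',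
  forall j, rmem s' aDist j = if (j < i)%N then mindist C' (point j) else rmem s1 aDist j,
  forall j, (j <= i)%N -> rmem s' aSum j = \sum_(0 <= l < j) mindist C' (point l),
  queries s' = queries s1 & (time s' <= time s1 + 10 + i * (50 * d + 200))%N].
apply: (@sim_seq _ _ _ _ _ _ _ (I n)); last first.
  move=> s' [fr ds sm qu ti]; apply: sim_ret; split=> /=.
  - exact: etrans (ram_output_frame (s' := tick 1 s') fr isT isT) out1.
  - by split=> // i lt_in; rewrite ds lt_in.
  - by apply: frame_trans fr1 _; apply: frame_sub fr.
  - by rewrite qu.
  - by lia.
have <- : neval s1 (nvar vN) = n by [].
apply: runs_for.
  split=> //=; last by lia.
  by move=> j; rewrite leqn0 => /eqP ->; rewrite big_nil S1.
move=> i s' lt_in [fr ds sm qu ti]; rewrite [neval _ _]N1 in lt_in.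
apply: sim_rset; set s2 := tick _ _.
have fr2 : frame [:: vI; vJ] [:: aDist; aSum; aAcc] s1 s2.
  by apply: frame_trans fr _; rewrite /s2; solve_frame.
have i2 : nmem s2 vI 0 = i by [].
have D2 j : rmem s2 aDist j = rmem s' aDist j by [].
have S2 j : rmem s2 aSum j = rmem s' aSum j by [].
have A2 : rmem s2 aAcc 0 = 0 by [].
have q2 : queries s2 = queries s1 by [].
have t2 : (time s2 <= time s' + 10)%N by rewrite /s2 /=; lia.
clearbody s2.
pose J j s3 := [/\ frame [:: vJ] [:: aAcc] s2 s3,
  rmem s3 aAcc 0 = \sum_(0 <= l < j) ((rmem (ram_input k X) aPt (i * d + l)%N
      - rmem (ram_input k X) aPt (x * d + l)%N)
      * (rmem (ram_input k X) aPt (i * d + l)%N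
      - rmem (ram_input k X) aPt (x * d + l)%N)),
  queries s3 = queries s2 & (time s3 <= time s2 + 10 + j * 50)%N].
apply: (@sim_seq _ _ _ _ _ _ _ (J d)).
  have eD : neval s2 (nvar vD) = d by rewrite /= fr2.1.
  rewrite (_ : J d = J (neval s2 (nvar vD))); last by rewrite eD.
  apply: runs_for; first by split=> //=; [rewrite big_nil A2 | lia].
  move=> j s3 _ [fr3 ac3 q3 t3]; apply: sim_ret; split=> //.
  - by apply: frame_trans fr3 _; solve_frame.
  - have i3 : nmem s3 vI 0 = i by rewrite fr3.1.
    have x3 : nmem s3 vX 0 = x by rewrite fr3.1 // fr2.1.
    have d3 : nmem s3 vD 0 = d by rewrite fr3.1 // fr2.1.
    have P3 l : rmem s3 aPt l = rmem (ram_input k X) aPt l.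
      by rewrite fr3.2 // fr2.2.
    by rewrite big_nat_recr //= -ac3 /= /upd /= i3 x3 d3 !P3.
  - by rewrite /=; lia.
move=> s3 [fr3 ac3 q3 t3]; rewrite ram_input_sqdist in ac3.
pose K s4 := [/\ frame [::] [:: aDist] s3 s4,
  forall j, rmem s4 aDist j = if j == i then mindist C' (point i) else rmem s3 aDist j,
  queries s4 = queries s3 & (time s4 <= time s3 + 50)%N].
have i3 : nmem s3 vI 0 = i by rewrite fr3.1.
have D3 j : rmem s3 aDist j = rmem s' aDist j by rewrite fr3.2.
apply: (@sim_seq _ _ _ _ _ _ _ K).
  apply: sim_if => /=; rewrite fr3.1 // fr2.1 // NC1 eqSS size_eq0.
  case: eqP => [C0|/eqP C0].
    apply: sim_ret; split=> //=; [by solve_frame | | by lia].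
    by move=> j; rewrite /upd /= i3 ac3 /C' C0 mindist1.
  apply: sim_if => /=; rewrite i3 ac3 D3 ds ltnn D1 (cC C0).1 //.
  have minE := mindist_rcons (point x) (point i) C0.
  case: ltP minE => le_m minE.
    apply: sim_ret; split=> //=; [by solve_frame | | by lia].
    by move=> j; rewrite /upd /= i3 ac3 minE.
  apply: sim_skip; apply: sim_ret; split=> //=; last by lia.
  by move=> j; case: eqP => // ->; rewrite D3 ds ltnn D1 (cC C0).1 // minE.
move=> s4 [fr4 D4 q4 t4]; apply: sim_rset; apply: sim_ret.
have i4 : nmem s4 vI 0 = i by rewrite fr4.1.
have S4 j : rmem s4 aSum j = rmem s' aSum j by rewrite fr4.2 // fr3.2.
have D4' j : rmem s4 aDist j =
    if (j < i.+1)%N then mindist C' (point j) else rmem s1 aDist j.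
  by rewrite D4 D3 ds ltnS; case: (ltngtP j i) => [||->].
split=> //=.
- apply: (@frame_trans _ _ _ _ s2) => //; apply: (@frame_trans _ _ _ _ s3).
    exact: frame_sub fr3.
  apply: (@frame_trans _ _ _ _ s4); first exact: frame_sub fr4.
  by solve_frame.
- move=> j le_j; rewrite /upd /= i4 addn1 S4 D4' leqnn.
  case: eqP => [->|/eqP j_neq]; first by rewrite big_nat_recr //= sm.
  by rewrite S4 sm // -ltnS ltn_neqAle j_neq.
- by rewrite q4 q3.
- by rewrite mulSn; lia.
Qed.

Definition dichotomy_step : cmd :=
  If (NLt (NAdd (nvar vLo) N1) (nvar vHi))
    (block [::
      nassign vI (NHalf (NAdd (nvar vLo) (nvar vHi)));
      Flip vCoin
        (RDiv (RSub (RGet aSum (nvar vI)) (RGet aSum (nvar vLo)))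
              (RSub (RGet aSum (nvar vHi)) (RGet aSum (nvar vLo))));
      If (NEq (nvar vCoin) N1)
        (nassign vHi (nvar vI))
        (nassign vLo (nvar vI))])
    Skip.

Definition sample_regs : seq nat := [:: vLo; vHi; vB; vI; vCoin; vX].

(* The weight [\sum_(lo <= x < hi) w x] multiplies the expectation because it can
   vanish, and then the division in the coin's bias is by 0. *)
Lemma dichotomy_spec (w : nat -> R) (F : state R -> R) (G : nat -> R) m i s lo hi :
    (forall x, 0 <= w x) ->
    (forall j, (j <= hi)%N -> rmem s aSum j = \sum_(0 <= x < j) w x) ->
    nmem s vLo 0 = lo -> nmem s vHi 0 = hi -> (lo < hi)%N -> (hi - lo <= 2 ^ m)%N ->
    (forall s' x, (lo <= x < hi)%N -> nmem s' vLo 0 = x ->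
       frame sample_regs [::] s s' -> queries s' = queries s ->
       (time s' <= time s + 80 * m)%N -> F s' = G x) ->
  (\sum_(lo <= x < hi) w x) * expect (iterate same vB dichotomy_step i m s) F
    = \sum_(lo <= x < hi) w x * G x.
Proof.
move=> w0; elim: m i s lo hi => [|m IHm] i s lo hi sum_s s_lo s_hi lt_lh le_m FG.
  (* No pass is left, and the range has at most 2^0 elements. *)
  have -> : hi = lo.+1 by rewrite expn0 in le_m; lia.
  rewrite !big_nat1 expect_dret (FG s lo) //; first by lia.
  by rewrite muln0 addn0.
have [W0|W_neq0] := eqVneq (\sum_(lo <= x < hi) w x) 0.
  rewrite W0 mul0r; move/eqP: W0; rewrite psumr_eq0 // => /allP w_eq0.
  by rewrite big_seq big1 // => x /w_eq0 /eqP ->; rewrite mul0r.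
rewrite [iterate _ _ _ _ _ _]/= expect_dbind expect_if; set s1 := tick (bcost _).+1 _.
have fr1 : frame sample_regs [::] s s1 by rewrite /s1; solve_frame.
have t1 : (time s1 <= time s + 10)%N by rewrite /s1 /=; lia.
rewrite [beval _ _]/= /upd /= s_lo s_hi addn1; case: ltnP => lt2; last first.
  rewrite expect_dret; apply: IHm => //; first by rewrite expnS in le_m; lia.
  move=> s' x x_in x_lo fr qu ti; apply: (FG s' x) => //.
    by apply: frame_trans fr1 _; apply: frame_trans fr; solve_frame.
  by rewrite /= in ti; lia.
have lo1 : nmem s1 vLo 0 = lo by [].
have hi1 : nmem s1 vHi 0 = hi by [].
have sum1 j : rmem s1 aSum j = rmem s aSum j by [].
have q1 : queries s1 = queries s by [].
clearbody s1.
set mid := ((lo + hi)./2)%N.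
have mid_lo : (lo < mid)%N by rewrite /mid; lia.
have mid_hi : (mid < hi)%N by rewrite /mid; lia.
have mid_m1 : (mid - lo <= 2 ^ m)%N by rewrite expnS in le_m; rewrite /mid; lia.
have mid_m2 : (hi - mid <= 2 ^ m)%N by rewrite expnS in le_m; rewrite /mid; lia.
rewrite !expect_seq expect_dret expect_seq expect_flip; set s2 := tick _ (nset _ _ _ _).
have mid2 : nmem s2 vI 0 = mid by rewrite /s2 /= /upd /= lo1 hi1.
have lo2 : nmem s2 vLo 0 = lo by [].
have hi2 : nmem s2 vHi 0 = hi by [].
have sum2 j : (j <= hi)%N -> rmem s2 aSum j = \sum_(0 <= x < j) w x.
  by move=> /sum_s <-; rewrite -sum1.
have q2 : queries s2 = queries s by [].
have fr2 : frame sample_regs [::] s s2.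
  by apply: frame_trans fr1 _; rewrite /s2; solve_frame.
have t2 : (time s2 <= time s + 20)%N by rewrite /s2 /=; lia.
clearbody s2.
set A := \sum_(lo <= x < mid) w x; set B := \sum_(mid <= x < hi) w x.
have WE : \sum_(lo <= x < hi) w x = A + B by rewrite (big_cat_nat _ (n := mid)) //; lia.
have A0 : 0 <= A by apply: sumr_ge0.
have B0 : 0 <= B by apply: sumr_ge0.
have sumE j : (lo <= j)%N -> \sum_(0 <= x < j) w x
    = \sum_(0 <= x < lo) w x + \sum_(lo <= x < j) w x.
  by move=> lo_j; rewrite (big_cat_nat _ (n := lo)).
have AE : rmem s2 aSum mid - rmem s2 aSum lo = A.
  by rewrite !sum2 ?(sumE mid) /A; [ring|lia|lia|lia].
have BE : rmem s2 aSum hi - rmem s2 aSum lo = A + B.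
  by rewrite -WE !sum2 ?(sumE hi); [ring|lia|lia|lia].
rewrite [reval _ _]/= mid2 lo2 hi2 AE BE WE; rewrite WE in W_neq0.
have W_gt0 : 0 < A + B by rewrite lt_def W_neq0 addr_ge0.
(* The bias lies in [0, 1], so the truncation made by [Flip] does not alter it. *)
have -> : Order.max 0 (Order.min 1 (A / (A + B))) = A / (A + B).
  rewrite min_r; first by rewrite max_r // divr_ge0 // ltW.
  by rewrite ler_pdivrMr // mul1r lerDl.
rewrite [RHS](big_cat_nat _ (n := mid)) //=; [|lia|lia].
(* Multiplied by the total weight, each branch is weighted by its own half, which is the form of the
   induction hypothesis. *)
have mix (a b : R) : (A + B) * (A / (A + B) * a + (1 - A / (A + B)) * b)
    = A * a + B * b by field.
rewrite mix; congr (_ + _).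
- rewrite /= expect_seq expect_if [beval _ _]/= /upd /= !expect_dret.
  set s3 := tick 1 _.
  have lo3 : nmem s3 vLo 0 = lo by [].
  have hi3 : nmem s3 vHi 0 = mid by [].
  apply: (IHm _ s3 lo mid) => //; first by move=> j j_mid; apply: sum2; lia.
  move=> s' x x_in x_lo fr qu ti; apply: (FG s' x) => //; first by lia.
    apply: frame_trans fr2 _; apply: frame_trans fr; rewrite /s3; solve_frame.
    by rewrite qu.
  by rewrite /s3 /= in ti; lia.
- rewrite /= expect_seq expect_if [beval _ _]/= /upd /= !expect_dret.
  set s3 := tick 1 _.
  have lo3 : nmem s3 vLo 0 = mid by [].
  have hi3 : nmem s3 vHi 0 = hi by [].
  apply: (IHm _ s3 mid hi) => //.
  move=> s' x x_in x_lo fr qu ti; apply: (FG s' x) => //; first by lia.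
    apply: frame_trans fr2 _; apply: frame_trans fr; rewrite /s3; solve_frame.
    by rewrite qu.
  by rewrite /s3 /= in ti; lia.
Qed.

Lemma sum_points (F : 'rV[R]_d -> R) :
  \sum_(x <- X) F x = \sum_(0 <= i < n) F (point i).
Proof. by rewrite (big_nth 0). Qed.

Lemma sim_rand a e s : neval s e = n ->
  sim (exec (Rand a e) s) (uniform R X) (fun s' y => exists2 i, (i < n)%N &
    y = point i /\ s' = tick (ncost e).+1 (nset a 0 i s)).
Proof.
move=> en F G FG; rewrite [LHS]expect_dmap !expect_uniform en size_iota.
rewrite sum_points /index_iota subn0; congr (_ * _); apply: eq_big_seq => i.
by rewrite mem_iota => lt_in; apply: FG; exists i.
Qed.

Lemma ram_D2_sample_spec C s :
    (0 < n)%N -> C != [::] -> data s -> nmem s vLN 0 = up_log 2 n -> costs C s ->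
  sim (exec ram_D2_sample s) (D2_sample X C) (fun s' y =>
    [/\ (nmem s' vX 0 < n)%N /\ y = point (nmem s' vX 0),
        frame sample_regs [::] s s', queries s' = queries s &
        (time s' <= time s + 100 * (up_log 2 n).+1)%N]).
Proof.
move=> n_gt0 C0 [sN sD sP] sLN [cD cS]; apply: sim_if => /=; rewrite sN cS //.
have PhiE : Phi C X = \sum_(0 <= j < n) mindist C (point j) by apply: sum_points.
rewrite -PhiE; case: eqP => [P0|/eqP P0].
  rewrite /D2_sample P0 eqxx /=.
  apply: (sim_mono (@sim_rand vX (nvar vN) (tick _ s) sN)).
  move=> s' y [i lt_in [-> ->]]; split=> //=; [by solve_frame | by lia].
move=> F G FG; rewrite expect_D2_sample //.
rewrite expect_seq expect_dret expect_seq expect_dret expect_seq expect_for.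
set s1 := tick (ncost (nvar vLN)).+1 _.
have LN1 : neval (tick (ncost (nvar vLN)).+1 s1) (nvar vLN) = up_log 2 n by [].
have lo1 : nmem s1 vLo 0 = 0%N by [].
have hi1 : nmem s1 vHi 0 = n by rewrite /s1 /= /upd /= sN.
have sum1 j : (j <= n)%N -> rmem s1 aSum j = \sum_(0 <= x < j) mindist C (point x).
  exact: cS.
have fr1 : frame sample_regs [::] s s1 by rewrite /s1; solve_frame.
have q1 : queries s1 = queries s by [].
have t1 : (time s1 <= time s + 20)%N by rewrite /s1 /=; lia.
rewrite -/dichotomy_step [neval _ _]LN1; clearbody s1.
(* Multiplying by the cost gives the weighted form of [dichotomy_spec] on [0, n), where [up_log 2 n]
   halvings leave a single index. *)
apply: (mulfI P0); rewrite mulrA divff // mul1r {1}PhiE.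
rewrite sum_points; apply: dichotomy_spec => //.
- by move=> x; apply: mindist_ge0.
- by rewrite subn0 up_logP.
move=> s' x x_in x_lo fr qu ti; rewrite expect_seq !expect_dret; apply: FG.
split=> /=.
- by rewrite /upd /= x_lo.
- by apply: (frame_trans fr1); solve_frame.
- by rewrite qu.
- by lia.
Qed.

Definition inner_body : cmd :=
  If (NEq (nvar vDone) N0)
    (block [::
      ram_D2_sample;
      ram_check;
      If (NEq (nvar vFound) N0)
        (block [:: ram_add_center; nassign vDone N1])
        Skip])
    Skip.

(** The number of queries has to agree exactly with the algorithm, whereas the clock is only
    bounded. *)
Definition ram_inv C q t s : Prop :=
  [/\ data s, nmem s vLN 0 = up_log 2 n /\ nmem s vLK 0 = up_log 2 k,
      ram_output X s = C /\ costs C s, queries s = q & (time s <= t)%N].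

Lemma data_frame ns rs s s' : frame ns rs s s' ->
  ~~ has (mem ns) [:: vN; vD] -> ~~ has (mem rs) [:: aPt] -> data s -> data s'.
Proof.
move=> [frn frr] /=; rewrite !orbF !negb_or => /andP [iN iD] iP [sN sD sP].
by split=> [||i]; rewrite ?frn ?frr.
Qed.

Lemma ram_inv_frame ns rs C q q' t t' s s' : frame ns rs s s' ->
  ~~ has (mem ns) [:: vN; vD; vLN; vLK; vCen; vNC] ->
  ~~ has (mem rs) [:: aPt; aDist; aSum] ->
  queries s' = q' -> (time s' <= t')%N -> ram_inv C q t s -> ram_inv C q' t' s'.
Proof.
move=> fr /=; rewrite !orbF !negb_or.
move=> /andP [iN /andP [iD /andP [iLN /andP [iLK /andP [iCen iNC]]]]].
move=> /andP [iP /andP [iDi iS]] qu ti [da [LN LK] [out [cD cS]] _ _]; split=> //.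
- by apply: data_frame fr _ _ da; rewrite /= !orbF ?negb_or ?iN.
- by rewrite !fr.1.
- rewrite (ram_output_frame fr) //; split=> //.
  by split=> i ?; rewrite fr.2 //; [apply: cD | apply: cS].
Qed.

(** This is the [break] of the inner loop: once the flag is set, the remaining passes only test
    it. *)
Lemma inner_done i m s : nmem s vDone 0 = 1%N ->
  runs (iterate same vS inner_body i m s) (fun s' =>
    [/\ frame [:: vS] [::] s s', queries s' = queries s
      & (time s' <= time s + 10 * m)%N]).
Proof.
move=> done1.
pose I j s' := [/\ frame [:: vS] [::] s s', queries s' = queries s
      & (time s' <= time s + 10 * (j - i))%N].
apply: sim_mono (runs_iterate (I := I) _ _) _.
- by split=> //; rewrite subnn muln0 addn0.
- move=> j s' ji [fr qu ti]; apply: sim_if => /=; rewrite /upd /= fr.1 // done1 /=.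
  apply: sim_ret; split=> //=; first by solve_frame.
  by lia.
- by move=> s' _ [fr qu ti]; split=> //; rewrite addKn in ti.
Qed.

(** The budget of one pass apart from inserting a center. The insertion, [add_time], happens at most
    once per outer iteration and is not multiplied by the number of samples; this keeps a factor log
    k away from the term nkd. *)
Definition step_time : nat := (100 * (up_log 2 n).+1 + 50 * k.+1 + 100)%N.

Definition add_time : nat := (200 + n * (50 * d + 200))%N.

Lemma inner_loop_spec m i C q t s : (0 < n)%N ->
    ram_inv C q t s -> nmem s vDone 0 = 0%N -> C != [::] -> (size C <= k)%N ->
  sim (iterate same vS inner_body i m s) (inner_loop X cl m (C, q)) (fun s' o =>
    [/\ ram_inv o.1 o.2 (t + m * step_time + add_time) s',
        (size o.1 <= (size C).+1)%N & o.1 != [::]]).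
Proof.
move=> n_gt0; elim: m i q t s => [|m IHm] i q t s I0 done0 C0 Ck.
  apply: sim_ret; split=> //=; apply: (ram_inv_frame (frame_refl [::] [::] s) _ _ _ _ I0) => //.
    by case: I0.
  by case: I0 => _ _ _ _; lia.
rewrite [iterate _ _ _ _ _ _]/= [inner_loop _ _ _ _]/=.
set s1 := tick 1 _.
have fr1 : frame [:: vS] [::] s s1 by rewrite /s1; solve_frame.
have body : exec inner_body s1 = exec (block [::
      ram_D2_sample;
      ram_check;
      If (NEq (nvar vFound) N0)
        (block [:: ram_add_center; nassign vDone N1])
        Skip]) (tick (bcost (NEq (nvar vDone) N0)).+1 s1).
  rewrite /inner_body /Defs.exec -/Defs.exec [beval _ _]/= /upd /=.
  by rewrite done0.
rewrite body {body}; set s2 := tick (bcost _).+1 s1.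
have I2 : ram_inv C q (t + 10) s2.
  apply: (ram_inv_frame (s' := s2) fr1 _ _ _ _ I0) => //=; first by case: I0.
  by case: I0 => _ _ _ _ /=; lia.
have done2 : nmem s2 vDone 0 = 0%N by [].
clearbody s2; move: s2 I2 done2 => {s1 fr1 s I0 done0} s I0 done0.
have [da [LN LK] [out co] qu ti] := I0.
apply: sim_seq_bind.
apply: (sim_bind (ram_D2_sample_spec n_gt0 C0 da LN co)).
move=> s1 y [[lt_x ->] fr1 q1 t1].
have I1 : ram_inv C q (t + 10 + 100 * (up_log 2 n).+1) s1.
  by apply: (ram_inv_frame fr1 _ _ _ _ I0); rewrite ?q1 //; lia.
have done1 : nmem s1 vDone 0 = 0%N by rewrite fr1.1.
have NC1 : nmem s1 vNC 0 = size C by case: I1 => _ _ [<- _] _ _; rewrite size_ram_output.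
apply: sim_seq_bind; apply: (runs_bind (@ram_check_spec R same s1)).
move=> s2 [found fr2 q2 t2]; rewrite NC1 in found q2 t2.
have x2 : nmem s2 vX 0 = nmem s1 vX 0 by rewrite fr2.1.
have I2 : ram_inv C (q + size C) (t + 10 + 100 * (up_log 2 n).+1 + 50 * k.+1) s2.
  apply: (ram_inv_frame fr2 _ _ _ _ I1) => //; first by rewrite q2 q1 qu.
  by case: I1 => _ _ _ _; lia.
have done2 : nmem s2 vDone 0 = 0%N by rewrite fr2.1.
(* The algorithm tests points, the machine tests indices. *)
have hasE : has (fun c => cl c == cl (point (nmem s1 vX 0))) C
    = has (fun i => same (nmem s1 vCen i) (nmem s1 vX 0)) (iota 0 (size C)).
  by rewrite -{1}(let: And5 _ _ (conj o _) _ _ := I1 in o) has_map NC1.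
rewrite hasE /=; apply: sim_seq_bind.
case: (has _ _) found => found.
  apply: (@runs_bind _ _ _ _ _ _ _ (fun s3 => ram_inv C (q + size C) (t + step_time) (tick 1 s3)
      /\ nmem s3 vDone 0 = 0%N)).
    apply: sim_if; rewrite /= found /=; apply: sim_ret; split=> //.
    apply: (ram_inv_frame (ns := [::]) (rs := [::]) _ _ _ _ _ I2);
      [by solve_frame | by [] | by [] | by case: I2 |].
    by case: I2 => _ _ _ _ /=; rewrite /step_time; lia.
  move=> s3 [I3 done3]; apply: sim_dbind_dret.
  have := IHm i.+1 _ _ _ I3 done3 C0 Ck.
  by rewrite mulSn addnA.
have [da2 _ [out2 co2] qu2 ti2] := I2.
apply: (@runs_bind _ _ _ _ _ _ _ (fun s3 =>
    ram_inv (rcons C (point (nmem s1 vX 0))) (q + size C) (t + step_time + add_time) (tick 1 s3)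
      /\ nmem s3 vDone 0 = 1%N)).
  apply: sim_if; rewrite /= found /=.
  apply: (sim_seq (@ram_add_center_spec C (tick _ s2) da2 out2 (fun _ => co2))).
  move=> s3 [out3 co3 fr3 q3 t3]; apply: sim_nset; apply: sim_ret; split=> //.
  rewrite /= x2 in out3 co3.
  split=> //=.
  - by apply: data_frame fr3 _ _ da2.
  - by rewrite /upd /= !fr3.1 //; case: I2.
  - by rewrite q3.
  - by rewrite /= in t3; rewrite /step_time /add_time; lia.
move=> s3 [I3 done3]; apply: sim_dbind_dret.
(* The algorithm has already returned, while the machine idles through its remaining passes. *)
apply: (runs_dret (@inner_done i.+1 m (tick 1 s3) done3)).
move=> s4 [fr4 q4 t4]; split; rewrite ?size_rcons ?rcons_neq0 //=.
apply: (ram_inv_frame fr4 _ _ _ _ I3) => //; first by rewrite q4; case: I3.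
by case: I3 => _ _ _ _; rewrite mulSn /step_time; lia.
Qed.

Definition outer_body : cmd :=
  block [:: nassign vDone N0; For vS (nvar vLK) inner_body].

Definition outer_time : nat := (up_log 2 k * step_time + add_time + 50)%N.

(** The bound on [size C + m] ensures that no test scans more than [k] centers, as the time budget
    assumes. *)
Lemma outer_loop_spec m i C q t s : (0 < n)%N ->
    ram_inv C q t s -> C != [::] -> (size C + m <= k)%N ->
  sim (iterate same vT outer_body i m s) (outer_loop X cl m (C, q))
    (fun s' o => ram_inv o.1 o.2 (t + m * outer_time) s').
Proof.
move=> n_gt0; elim: m i C q t s => [|m IHm] i C q t s I0 C0 Ck.
  by apply: sim_ret; rewrite addn0.
rewrite [iterate _ _ _ _ _ _]/= [outer_loop _ _ _ _]/=.
apply: (@sim_bind _ _ _ _ _ _ _ _ _ (fun s' o =>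
    [/\ ram_inv o.1 o.2 (t + outer_time) s',
        (size o.1 <= (size C).+1)%N & o.1 != [::]])); last first.
  move=> s' [C' q'] /= [I1 C1 C1'].
  have := IHm i.+1 _ _ _ _ I1 C1'.
  by rewrite mulSn addnA; apply; lia.
apply: sim_nset; set s1 := tick _ (nset _ _ _ _).
have I1 : ram_inv C q (t + 10) (tick (ncost (nvar vLK)).+1 s1).
  apply: (ram_inv_frame (ns := [:: vT; vDone]) (rs := [::]) _ _ _ _ _ I0) => //.
  - by rewrite /s1; solve_frame.
  - by case: I0.
  - by case: I0 => _ _ _ _ /=; lia.
have done1 : nmem (tick (ncost (nvar vLK)).+1 s1) vDone 0 = 0%N by [].
have LK1 : neval s1 (nvar vLK) = up_log 2 k by case: I1 => _ [].
have Ck' : (size C <= k)%N by lia.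
have loop := @inner_loop_spec (up_log 2 k) 0 _ _ _ _ n_gt0 I1 done1 C0 Ck'.
rewrite -{1}LK1 in loop.
apply: (sim_bind_ret (sim_for loop)).
move=> s2 [C2 q2] [I2 C2k C20]; apply: sim_ret; split=> //.
apply: (ram_inv_frame (ns := [::]) (rs := [::]) _ _ _ _ _ I2);
  [by solve_frame | by [] | by [] | by case: I2 |].
by case: I2 => _ _ _ _ /=; rewrite /outer_time; lia.
Qed.

Definition total_time : nat :=
  (50 * k.+1 + 50 * n.+1 + 50 + add_time + k.-1 * outer_time)%N.

(** Output and query count agree exactly, which gives equality of laws; the deterministic time bound
    is carried along. *)
Lemma ram_query_kmeanspp_spec : (0 < n)%N -> (0 < k)%N ->
  sim (exec ram_query_kmeanspp (ram_input k X)) (query_kmeanspp X cl)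
    (fun s o => (ram_output X s, queries s) = o /\ (time s <= total_time)%N).
Proof.
move=> n_gt0 k_gt0; set s0 := ram_input k X.
have k0 : nmem s0 vK 0 = k by [].
have n0 : nmem s0 vN 0 = n by [].
have d0 : nmem s0 vD 0 = d by [].
have t0 : time s0 = 0%N by [].
have q0 : queries s0 = 0%N by [].
have P0 i : rmem s0 aPt i = rmem (ram_input k X) aPt i by [].
clearbody s0.
apply: (sim_seq (@ram_log_spec R same vLK vK s0 isT isT isT isT isT _)); first by rewrite k0.
rewrite k0 => s1 [LK1 fr1 q1 t1].
apply: (sim_seq (@ram_log_spec R same vLN vN s1 isT isT isT isT isT _)).
  by rewrite fr1.1 // n0.
rewrite fr1.1 // n0 => s2 [LN2 fr2 q2 t2].
apply: sim_nset; set s3 := tick _ _.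
have fr3 : frame [:: vLK; vLN; vNC; vPow; vI] [::] s0 s3.
  apply: (frame_trans (frame_sub _ _ fr1)) => //.
  by apply: (frame_trans (frame_sub _ _ fr2)) => //; rewrite /s3; solve_frame.
have LK3 : nmem s3 vLK 0 = up_log 2 k by rewrite -LK1; apply: fr2.1.
have LN3 : nmem s3 vLN 0 = up_log 2 n by [].
have NC3 : nmem s3 vNC 0 = 0%N by [].
have q3 : queries s3 = 0%N by rewrite [LHS]q2 q1.
have t3 : (time s3 <= 50 * k.+1 + 50 * n.+1 + 10)%N by rewrite /s3 /=; lia.
clearbody s3.
have n3 : nmem s3 vN 0 = n by rewrite fr3.1.
apply: (sim_seq_dbind (@sim_rand vX (nvar vN) s3 n3)).
move=> _ y [x lt_xn [-> ->]]; set s4 := tick _ _.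
have da4 : data s4.
  by split=> [||i]; rewrite [LHS]/= /upd /= ?n3 ?fr3.1 ?fr3.2.
have out4 : ram_output X s4 = [::] by rewrite /ram_output [nmem _ _ _]NC3.
have co4 : [::] != [::] :> seq 'rV[R]_d -> costs [::] s4 by [].
apply: (sim_seq (@ram_add_center_spec [::] s4 da4 out4 co4)).
move=> s5 [out5 co5 fr5 q5 t5]; rewrite /= in out5 co5.
have I5 : ram_inv [:: point x] 0 (50 * k.+1 + 50 * n.+1 + 20 + add_time) s5.
  split=> //.
  - by apply: data_frame fr5 _ _ da4.
  - by rewrite !fr5.1.
  - by rewrite q5.
  - by rewrite /= in t5; rewrite /add_time; lia.
have K5 : neval s5 (NSub (nvar vK) N1) = k.-1.
  by rewrite /= fr5.1 // [nmem s4 _ _]fr3.1 // k0 subn1.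
have I6 : ram_inv [:: point x] 0 (50 * k.+1 + 50 * n.+1 + 40 + add_time)
    (tick (ncost (NSub (nvar vK) N1)).+1 s5).
  apply: (ram_inv_frame (ns := [::]) (rs := [::]) _ _ _ _ _ I5);
    [by solve_frame | by [] | by [] | by case: I5 |].
  by case: I5 => _ _ _ _ /=; lia.
have sk : (size [:: point x] + k.-1 <= k)%N by rewrite /=; lia.
have loop := @outer_loop_spec k.-1 0 _ _ _ _ n_gt0 I6 isT sk.
rewrite -{1}K5 in loop.
apply: (sim_bind_ret (sim_for loop)).
move=> s7 [C q] [_ _ [/= out7 _] q7 t7]; apply: sim_ret; split.
  by congr (_, _).
by rewrite /= /total_time; lia.
Qed.

End Implementation.

(** * Query complexity *)

Section Queries.
Variables (R : realFieldType) (d k : nat) (X : seq 'rV[R]_d) (cl : 'rV[R]_d -> 'I_k).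

Lemma inner_loop_queries m C q :
  all (fun p => (size p.2.1 <= (size C).+1) && (p.2.2 <= q + m * size C))%N
    (inner_loop X cl m (C, q)).
Proof.
elim: m q => [|m IHm] q /=; first by rewrite leqnSn addn0 leqnn.
rewrite all_dbind; apply/allP => p _ /=; case: ifP => _.
  by apply: sub_all (IHm _) => o /=; rewrite mulSn addnA.
by rewrite /= size_rcons leqnn mulSn addnA leq_addr.
Qed.

(** Each iteration draws at most [up_log 2 k] samples and tests each against at most [k] centers. *)
Lemma outer_loop_queries m C q : (size C + m <= k)%N ->
  all (fun p => p.2.2 <= q + m * (up_log 2 k * k))%N (outer_loop X cl m (C, q)).
Proof.
elim: m C q => [|m IHm] C q Ck /=; first by rewrite addn0 leqnn.
rewrite all_dbind; apply: sub_all (inner_loop_queries _ _ _) => -[w [C' q']] /=.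
case/andP => C'C q'q; apply: sub_all (IHm C' q' _); last by lia.
move=> o /= /leq_trans; apply; rewrite mulSn addnA leq_add2r.
by apply: leq_trans q'q _; rewrite leq_add2l leq_mul2l; lia.
Qed.

Lemma query_kmeanspp_queries : (0 < k)%N ->
  all (fun p => p.2.2 <= k * (up_log 2 k * k))%N (query_kmeanspp X cl).
Proof.
move=> k_gt0; rewrite all_dbind; apply/allP => p _ /=.
apply: sub_all (outer_loop_queries _ _) => [o /= /leq_trans|]; last by rewrite /=; lia.
by apply; rewrite add0n leq_mul2r leq_pred orbT.
Qed.

End Queries.

(** * Constants in the asymptotic bounds *)

Lemma up_log_le_ln (R : realType) m : (0 < m)%N ->
  (up_log 2 m)%:R * ln 2 <= 2 * ln m%:R :> R.
Proof.
move=> m_gt0; have [m1|m_gt1] := leqP m 1.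
  have -> : m = 1%N by lia.
  by rewrite up_log1 mul0r ln1 mulr0.
have m_pos : 0 < m%:R :> R by rewrite ltr0n.
have ln2_le : ln 2 <= ln m%:R :> R by rewrite ler_ln ?posrE // ler_nat.
(* Here 2^l < m, so l ln 2 <= ln m; rounding up adds ln 2 <= ln m once more, whence the factor 2. *)
have [l L_eq] : exists l, up_log 2 m = l.+1.
  by exists (up_log 2 m).-1; rewrite prednK // up_log_gt0.
have lt_m : (2 ^ l < m)%N by rewrite -[l]/(l.+1.-1) -L_eq up_log_gtn.
have : l%:R * ln 2 <= ln m%:R :> R.
  rewrite mulr_natl -lnXn // ler_ln ?posrE ?exprn_gt0 //.
  by rewrite -natrX ler_nat ltnW.
by rewrite L_eq -natr1; lra.
Qed.

Lemma total_time_le (R : realFieldType) (d k : nat) (X : seq 'rV[R]_d) :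
    (0 < size X)%N -> (0 < d)%N -> (1 < k)%N ->
  (total_time k X <= 2000 * (size X * k * d + k * up_log 2 k * up_log 2 (size X)
                              + k * k * up_log 2 k))%N.
Proof.
move=> n_gt0 d_gt0 k_gt1; have L_gt0 : (0 < up_log 2 k)%N by rewrite up_log_gt0.
rewrite /total_time /outer_time /step_time /add_time.
move: (size X) (up_log 2 (size X)) (up_log 2 k) n_gt0 L_gt0 => n LN L n_gt0 L_gt0.
(* Positive quantities are written as successors to make the polynomial comparison explicit. [LN] is
   not, since it is 0 when n = 1. *)
have -> : k = k.-1.+1 by lia.
move: k.-1 => {k k_gt1} k /=.
have -> : n = n.-1.+1 by lia.
have -> : d = d.-1.+1 by lia.
have -> : L = L.-1.+1 by lia.
nia.
Qed.

Theorem theorem6 (R : realType) :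
  exists c : R,
  forall (n d k : nat) (X : n.-tuple 'rV[R]_d) (cl : 'rV[R]_d -> 'I_k),
    (0 < n)%N -> (0 < d)%N -> (1 < k)%N -> uniq X -> optimal_clustering X cl ->
    [/\ expect (query_kmeanspp X cl) (fun o => Phi o.1 X) <= 24 * Delta k X,
        surely (query_kmeanspp X cl)
          (fun o => o.2%:R <= c * (k%:R ^+ 2 * ln k%:R)),
        forall o : seq 'rV[R]_d * nat,
          pmf (dmap fst (ram_run X cl)) o = pmf (query_kmeanspp X cl) o
      & surely (ram_run X cl)
          (fun o => o.2%:R <=
             c * (n%:R * k%:R * d%:R + k%:R * ln k%:R * ln n%:R
                  + k%:R ^+ 2 * ln k%:R))].
Proof.
(* The price of replacing one rounded binary logarithm by a natural one. *)
pose b : R := 2 / ln 2.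
have ln2_gt0 : 0 < ln 2 :> R by rewrite ln_gt0 // ltr1n.
have b_ge0 : 0 <= b by rewrite divr_ge0 // ltW.
have log_le m : (0 < m)%N -> (up_log 2 m)%:R <= b * ln m%:R.
  by move=> m_gt0; rewrite /b mulrAC ler_pdivlMr // up_log_le_ln.
(* The three terms of the time bound contain zero, two and one rounded logarithms, hence the factors
   1, b^2 and b. Their sum covers each of them. *)
exists (2000 * (1 + b + b ^+ 2)) => n d k X cl n_gt0 d_gt0 k_gt1 _ opt.
have k_gt0 : (0 < k)%N by apply: ltnW.
have X_gt0 : (0 < size X)%N by rewrite size_tuple.
have logk := log_le k k_gt0; have logn := log_le n n_gt0.
have lnk0 : 0 <= ln k%:R :> R by rewrite ln_ge0 // ler1n.
have lnn0 : 0 <= ln n%:R :> R by rewrite ln_ge0 // ler1n.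
have k2_le : k%:R * k%:R * (up_log 2 k)%:R <= b * (k%:R ^+ 2 * ln k%:R) :> R.
  by rewrite mulrCA -expr2 ler_wpM2l ?sqr_ge0.
have kn_le : k%:R * (up_log 2 k)%:R * (up_log 2 n)%:R
    <= b ^+ 2 * (k%:R * ln k%:R * ln n%:R) :> R.
  have -> : b ^+ 2 * (k%:R * ln k%:R * ln n%:R)
      = k%:R * ((b * ln k%:R) * (b * ln n%:R)) by ring.
  by rewrite -mulrA ler_wpM2l // ler_pM.
have b2_ge0 := sqr_ge0 b.
split.
- by rewrite -opt; apply: query_kmeanspp_cost.
- move=> w y /(allP (query_kmeanspp_queries X cl k_gt0)) /= q_le _.
  apply: (@le_trans _ _ (k%:R * k%:R * (up_log 2 k)%:R)).
    by rewrite -!natrM ler_nat (leq_trans q_le) // mulnCA mulnC.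
  apply: le_trans k2_le _; rewrite ler_wpM2r ?mulr_ge0 ?sqr_ge0 //; lra.
- move=> o; rewrite !pmf_expect !expect_dmap.
  by apply: (ram_query_kmeanspp_spec cl X_gt0 k_gt0) => s t [] /= ->.
- have time_le := total_time_le X_gt0 d_gt0 k_gt1.
  apply: (@sim_surely _ _ _ _ _ _ _ _ (fun o => o.2%:R <= _)
    (ram_query_kmeanspp_spec cl X_gt0 k_gt0)); last exact: exec_ge0.
  move=> s t [_ /leq_trans /(_ time_le)]; rewrite size_tuple -(ler_nat R) => /le_trans.
  apply; rewrite !natrM !natrD !natrM.
  set u := n%:R * k%:R * d%:R; set v := k%:R * ln k%:R * ln n%:R.
  set z := k%:R ^+ 2 * ln k%:R in k2_le *.
  have u0 : 0 <= u by rewrite !mulr_ge0.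
  have v0 : 0 <= v by rewrite !mulr_ge0.
  have z0 : 0 <= z by rewrite !mulr_ge0 ?sqr_ge0.
  have bu := mulr_ge0 b_ge0 u0; have b2u := mulr_ge0 b2_ge0 u0.
  have bv := mulr_ge0 b_ge0 v0; have b2z := mulr_ge0 b2_ge0 z0.
  rewrite -/v in kn_le; lra.
Qed.
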